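(* Let $n\ge 2$. Any bijective transform $T:Cvx_0(\mathbb{R}^n)\to Cvx_0(\mathbb{R}^n)$ such that both $T$ and $T^{-1}$ are almost order reversing (with constant $\tilde C>1$) satisfies one of the following conditions: either (a) for all $f\in Cvx_0(\mathbb{R}^n)$: $\; c\,(\mathcal{A}f)\circ B\le Tf\le C\,(\mathcal{A}f)\circ B$, or (b) for all $f\in Cvx_0(\mathbb{R}^n)$: $\; c\,(\mathcal{L}f)\circ B\le Tf\le C\,(\mathcal{L}f)\circ B$, where $B\in GL(n)$ and $c,C$ are positive constants depending only on $\tilde C$.
   Context: $Cvx_0(\mathbb{R}^n)$ is the class of geometric convex functions: lower semicontinuous convex $f:\mathbb{R}^n\to[0,+\infty]$ with $f(0)=0$. Inequalities between functions are pointwise. For $\tilde C>1$ and $\tilde c=\tilde C^{-1}$, a bijection $T$ of $Cvx_0(\mathbb{R}^n)$ is $\tilde C$-almost order reversing if for all $f,g$ in the class: (i) $f\le g$ implies $Tf\ge\tilde c\,Tg$; (ii) $f\le\tilde c\,g$ implies $Tf\ge Tg$. It is called almost order reversing if this holds for some constant $\tilde C>1$. The Legendre transform is $(\mathcal{L}f)(x)=\sup_{y}(\langle x,y\rangle-f(y))$. The geometric transform $\mathcal{A}:Cvx_0(\mathbb{R}^n)\to Cvx_0(\mathbb{R}^n)$ is $(\mathcal{A}f)(x)=\sup_{\{y:\,f(y)>0\}}\frac{\langle x,y\rangle-1}{f(y)}$ if $x\in\{y:f(y)=0\}^{\circ}$, and $(\mathcal{A}f)(x)=+\infty$ otherwise;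 here $K^\circ=\{x:\langle x,y\rangle\le1\ \forall y\in K\}$ and $\sup\emptyset=0$.
   Formalization: The bounds carry an extra factor λ>0 that may depend on T: cλ(Af)∘B ≤ Tf ≤ Cλ(Af)∘B (likewise for L), with c, C depending only on C̃; without it the claim fails for T=λA with λ large. *)

(* Defs.v *)
From HB Require Import structures.
From mathcomp Require Import all_boot all_order all_algebra.
From mathcomp Require Import all_classical all_reals all_analysis.

Set Implicit Arguments.
Unset Strict Implicit.
Unset Printing Implicit Defensive.

Import Order.TTheory GRing.Theory Num.Theory.
Import numFieldNormedType.Exports.

Local Open Scope classical_set_scope.
Local Open Scope ring_scope.

Definition dotp (R : realType) (n : nat) (x y : 'cV[R]_n) : R :=
  \sum_(i < n) x i 0 * y i 0.

(* The convention 0 * +oo = 0 of \bar R makes the endpoints t = 0 and t = 1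
   trivial, so this is the usual convexity of extended-valued functions. *)
Definition econvex (R : realType) (n : nat) (f : 'cV[R]_n -> \bar R) : Prop :=
  forall (x y : 'cV[R]_n) (t : R), 0 <= t <= 1 ->
    (f (t *: x + (1 - t) *: y)%R <= t%:E * f x + (1 - t)%R%:E * f y)%E.

Record cvx0 (R : realType) (n : nat) := Cvx0 {
  cvx0_fun :> 'cV[R]_n -> \bar R;
  cvx0_ge0 : forall x, (0 <= cvx0_fun x)%E;
  cvx0_at0 : cvx0_fun 0 = 0%E;
  cvx0_convex : econvex cvx0_fun;
  cvx0_lsc : lower_semicontinuous cvx0_fun
}.

Definition legendre (R : realType) (n : nat) (f : 'cV[R]_n -> \bar R)
    (x : 'cV[R]_n) : \bar R :=
  ereal_sup [set ((dotp x y)%:E - f y)%E | y in setT].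

Definition polar (R : realType) (n : nat) (K : set 'cV[R]_n) : set 'cV[R]_n :=
  [set x | forall y, K y -> dotp x y <= 1].

(* Supremum in [0, +oo], where sup set0 = 0, whereas ereal_sup set0 = -oo. *)
Definition ereal_sup0 (R : realType) (S : set (\bar R)) : \bar R :=
  if `[< S !=set0 >] then ereal_sup S else 0%E.

(* In \bar R one has +oo^-1 = 0, so points y with f y = +oo contribute 0. *)
Definition geometric_transform (R : realType) (n : nat)
    (f : 'cV[R]_n -> \bar R) (x : 'cV[R]_n) : \bar R :=
  if `[< polar [set y | f y = 0%E] x >] then
    ereal_sup0 [set ((dotp x y - 1)%R%:E / f y)%E | y in [set y | (0 < f y)%E]]
  else +oo%E.

Definition almost_order_reversing (R : realType) (n : nat) (Ct : R)
    (T : cvx0 R n -> cvx0 R n) : Prop :=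
  forall f g : cvx0 R n,
    ((forall x, (f x <= g x)%E) ->
       forall x, (Ct^-1%R%:E * T g x <= T f x)%E) /\
    ((forall x, (f x <= Ct^-1%R%:E * g x)%E) ->
       forall x, (T g x <= T f x)%E).

(* Main.v *)
(* Composing [T] with the geometric transform [gtr] (an order reversing involution) yields a map [S]
   that is almost order preserving together with its inverse. Comparisons with functions taking only
   the values 0 and +oo are not affected by multiplicative constants, so [S] respects them exactly.
   Consequently [S] permutes the indicators of rays. On a ray, the indicator [seg z] of the segment
   [0, z] is prime for both max and min, and the only such functions are the [seg y] and the linear
   [lin y], so that [S] sends every [seg z] to one of these; in dimension at least 2 the same
   alternative holds for all [z].
   If [S (seg z) = seg (phi z)], or else [S (lin z) = seg (phi z)], then [phi] preserves triangles
   with a vertex at the origin, hence is linear. In the second case the image of the triangle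
   functions [tri z c = max (seg z) (lin (z / c))] is determined up to the factor [Ct], which gives the
   Legendre transform; in the first case, comparing triangle functions on different rays shows that
   their heights are multiplied by a factor that is constant up to a power of [Ct], which gives the
   geometric transform. *)
Require Import Defs.
From mathcomp Require Import all_boot all_order all_algebra.
From mathcomp Require Import all_classical all_reals all_analysis.
From mathcomp Require Import ring lra.

Import Order.TTheory GRing.Theory Num.Theory.
Import numFieldNormedType.Exports.

Local Open Scope classical_set_scope.
Local Open Scope ring_scope.

Set Implicit Arguments.
Unset Strict Implicit.
Unset Printing Implicit Defensive.

(** * Euclidean geometry *)

(** The obstacle is that [S] controls general functions only up to a factor, so every exact
    statement is reduced to a comparison in which one side, or its image, is an indicator. Such
    comparisons reach all functions because [f z <= c] is the same as [f <= tri z c], and [tri z c]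
    is the maximum of [seg z] and [lin (c^-1 *: z)]. Inequalities are tested against real bounds
    [r > 0], which keeps +oo out of the computations. The two alternatives have two models: the
    identity, and the perspective map sending an epigraph point [(x, v)] to [(v^-1 *: x, v^-1)]. The
    latter exchanges [seg z] with [lin z] and relates the Legendre transform to the geometric one
    ([legendre_gtr]). The factor [lam] of the conclusion depends on [T]: multiplying all values of
    [T f] by a positive constant preserves the hypotheses, so this normalisation cannot be bounded
    in terms of [Ct]. *)

Section DotProduct.
Variables (R : realType) (n : nat).
Implicit Types (x y z u : 'cV[R]_n) (a b r s t : R).

Lemma dotpC x y : dotp x y = dotp y x.
Proof. by apply: eq_bigr => i _; rewrite mulrC. Qed.

Lemma dotpDr x y z : dotp x (y + z) = dotp x y + dotp x z.
Proof. by rewrite -big_split; apply: eq_bigr => i _; rewrite mxE mulrDr. Qed.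

Lemma dotpZr a x y : dotp x (a *: y) = a * dotp x y.
Proof. by rewrite mulr_sumr; apply: eq_bigr => i _; rewrite mxE mulrCA. Qed.

Lemma dotpNr x y : dotp x (- y) = - dotp x y.
Proof. by rewrite -scaleN1r dotpZr mulN1r. Qed.

Lemma dotp0r x : dotp x 0 = 0.
Proof. by rewrite -(scale0r x) dotpZr mul0r. Qed.

Lemma dotpDl x y z : dotp (x + y) z = dotp x z + dotp y z.
Proof. by rewrite dotpC dotpDr !(dotpC z). Qed.

Lemma dotpZl a x y : dotp (a *: x) y = a * dotp x y.
Proof. by rewrite dotpC dotpZr dotpC. Qed.

Lemma dotpNl x y : dotp (- x) y = - dotp x y.
Proof. by rewrite dotpC dotpNr dotpC. Qed.

Lemma dotp0l x : dotp 0 x = 0.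
Proof. by rewrite dotpC dotp0r. Qed.

Definition dotpE := (dotpDr, dotpZr, dotpNr, dotpDl, dotpZl, dotpNl, dotp0l, dotp0r).

Lemma dotp_coord_le x i : x i 0 ^+ 2 <= dotp x x.
Proof.
rewrite /dotp (bigD1 i) //= -expr2 lerDl sumr_ge0 // => j _.
by rewrite -expr2 sqr_ge0.
Qed.

Lemma dotp_ge0 x : 0 <= dotp x x.
Proof. by apply: sumr_ge0 => j _; rewrite -expr2 sqr_ge0. Qed.

Lemma dotp_eq0 x : (dotp x x == 0) = (x == 0).
Proof.
apply/eqP/eqP => [x0|->]; last by rewrite dotp0r.
apply/matrixP => i j; rewrite (ord1 j) mxE; apply/eqP.
by rewrite -sqrf_eq0 eq_le sqr_ge0 andbT -x0 dotp_coord_le.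
Qed.

Lemma dotp_gt0 x : (0 < dotp x x) = (x != 0).
Proof. by rewrite lt_def dotp_eq0 dotp_ge0 andbT. Qed.

Lemma dotp_continuous u : continuous (dotp u).
Proof.
move=> x; have FF : Filter (nbhs x) by exact: nbhs_filter.
apply: (@cvg_big _ _ +%R 0 xpredT) => [|i _]; first exact: add_continuous.
by apply: cvgM; [exact: cvg_cst | exact: coord_continuous].
Qed.

Definition indep x y := forall a b, a *: x + b *: y = 0 -> a = 0 /\ b = 0.

Lemma indepC x y : indep x y -> indep y x.
Proof. by move=> xy a b; rewrite addrC => /xy[]. Qed.

Lemma indep_neq0 x y : indep x y -> x != 0.
Proof.
move=> xy; apply/eqP => x0; have [] := xy 1 0.
  by rewrite x0 scaler0 scale0r addr0.
by move/eqP; rewrite oner_eq0.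
Qed.

(** Gram-Schmidt: the component [p] of one vector orthogonal to the other, divided by [dotp p p], is
    dual to the pair. The solution is kept in the span because [farkas2] uses it as an orthogonal
    projection. *)
Lemma indep_dual_span x y a b : indep x y ->
  exists s t, dotp (s *: x + t *: y) x = a /\ dotp (s *: x + t *: y) y = b.
Proof.
suff perp x' y' : indep x' y' ->
    exists s t, dotp (s *: x' + t *: y') x' = 1 /\ dotp (s *: x' + t *: y') y' = 0.
  move=> xy; have [s [t [ux uy]]] := perp _ _ xy.
  have [s' [t' []]] := perp _ _ (indepC xy); rewrite addrC => vy vx.
  exists (a * s + b * t'), (a * t + b * s').
  have -> : (a * s + b * t') *: x + (a * t + b * s') *: y =
      a *: (s *: x + t *: y) + b *: (t' *: x + s' *: y).
    by rewrite !scalerDr !scalerA !scalerDl addrACA.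
  by rewrite !(dotpDl (a *: _)) !(dotpZl a) !(dotpZl b) ux uy vx vy; split; ring.
move=> xy; have y0 := indep_neq0 (indepC xy).
have yy : dotp y' y' != 0 by rewrite dotp_eq0.
set c := dotp x' y' / dotp y' y'; pose p := x' - c *: y'.
have py : dotp p y' = 0 by rewrite !dotpE /c divfK // subrr.
have p0 : p != 0.
  apply/eqP => p0; have [] := xy 1 (- c).
    by rewrite scale1r scaleNr.
  by move/eqP; rewrite oner_eq0.
have px : dotp p x' = dotp p p.
  have -> : dotp p p = dotp p x' - c * dotp p y' by rewrite -dotpZr -dotpNr -dotpDr.
  by rewrite py mulr0 subr0.
exists (dotp p p)^-1, (- ((dotp p p)^-1 * c)).
have -> : (dotp p p)^-1 *: x' + - ((dotp p p)^-1 * c) *: y' = (dotp p p)^-1 *: p.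
  by rewrite scalerBr scaleNr scalerA.
by rewrite !dotpZl py mulr0 px mulVf // dotp_eq0.
Qed.

Lemma indep_dual x y a b : indep x y -> exists u, dotp u x = a /\ dotp u y = b.
Proof. by move=> /(indep_dual_span a b)[s [t H]]; exists (s *: x + t *: y). Qed.

Lemma indepZ x y a b : a != 0 -> b != 0 -> indep x y -> indep (a *: x) (b *: y).
Proof.
move=> a0 b0 xy c d; rewrite !scalerA => /xy[/eqP + /eqP].
by rewrite !mulf_eq0 (negPf a0) (negPf b0) !orbF => /eqP-> /eqP->.
Qed.

Lemma indep_comb x y a b c d :
  a * d - b * c != 0 -> indep x y -> indep (a *: x + b *: y) (c *: x + d *: y).
Proof.
move=> D xy p q e.
have [] := xy (p * a + q * c) (p * b + q * d).
  rewrite -[RHS]e !scalerDr !scalerDl !scalerA.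
  by rewrite addrACA.
move=> e1 e2.
have p0 : p * (a * d - b * c) = 0.
  by rewrite (_ : _ * _ = (p * a + q * c) * d - (p * b + q * d) * c); [rewrite e1 e2; ring | ring].
have q0 : q * (a * d - b * c) = 0.
  by rewrite (_ : _ * _ = (p * b + q * d) * a - (p * a + q * c) * b); [rewrite e1 e2; ring | ring].
by split; apply/eqP; [move/eqP: p0 | move/eqP: q0]; rewrite mulf_eq0 (negPf D) orbF.
Qed.

Lemma dependent_scale x y : x != 0 -> ~ indep x y -> exists a, y = a *: x.
Proof.
move=> x0 dep; apply: contrapT => H; apply: dep => a b e.
have b0 : b = 0.
  apply/eqP/negPn/negP => b0; apply: H; exists (- (a / b)).
  apply: (scalerI b0); rewrite scalerA mulrN mulrCA divff // mulr1 scaleNr.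
  by apply/eqP; rewrite -addr_eq0 addrC e.
split=> //; move: e; rewrite b0 scale0r addr0 => /eqP.
by rewrite scaler_eq0 (negPf x0) orbF => /eqP.
Qed.

Lemma exists_indep x : (1 < n)%N -> x != 0 -> exists y, indep x y.
Proof.
move=> n1 x0; apply: contrapT => H.
have dep y : exists a, y = a *: x.
  by apply: dependent_scale => //; apply: contra_not H => ?; exists y.
pose i0 := Ordinal (ltnW n1); pose i1 := Ordinal n1.
have [a ea] := dep (delta_mx i0 0); have [b eb] := dep (delta_mx i1 0).
have/matrixP/(_ i0 0) := ea; have/matrixP/(_ i1 0) := ea.
have/matrixP/(_ i1 0) := eb; rewrite !mxE !eqxx /= => e1 e2 e3.
have a0 : a != 0 by apply/eqP => a0; move: e3; rewrite a0 mul0r => /eqP; rewrite oner_eq0.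
move/esym/eqP: e2; rewrite mulf_eq0 (negPf a0) /= => /eqP x10.
by move: e1; rewrite x10 mulr0 => /eqP; rewrite oner_eq0.
Qed.

Lemma exists_indep2 x y : (1 < n)%N -> x != 0 -> y != 0 ->
  exists z, indep x z /\ indep y z.
Proof.
move=> n1 x0 y0; case: (pselect (indep x y)) => [xy|/(dependent_scale x0)[a ya]].
  exists (x + y); split.
    have := @indep_comb x y 1 0 1 1; rewrite !scale1r scale0r addr0.
    by apply => //; rewrite mul1r mul0r subr0 oner_neq0.
  have := @indep_comb x y 0 1 1 1; rewrite !scale1r scale0r add0r.
  by apply => //; rewrite mul1r mul0r add0r oppr_eq0 oner_neq0.
have [z xz] := exists_indep n1 x0; exists z; split => //.
rewrite ya -(scale1r z); apply: indepZ => //; rewrite ?oner_neq0 //.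
by apply: contra_neq y0 => a0; rewrite ya a0 scale0r.
Qed.

Lemma scaler_inj z s t : z != 0 -> s *: z = t *: z -> s = t.
Proof.
move=> z0 /eqP; rewrite -subr_eq0 -scalerBl scaler_eq0 (negPf z0) orbF subr_eq0.
by move/eqP.
Qed.

(** Bipolar theorem for a cone with two generators. Testing with [z - q], where [q] is the
    projection of [z] onto the span, gives [z = q]; for independent generators the negatives of the
    dual vectors then give the signs of the coefficients. *)
Lemma farkas2 x y z : x != 0 -> y != 0 ->
  (forall u, dotp u x <= 0 -> dotp u y <= 0 -> dotp u z <= 0) ->
  exists a b, [/\ 0 <= a, 0 <= b & z = a *: x + b *: y].
Proof.
move=> x0 y0 H; have xx : 0 < dotp x x by rewrite dotp_gt0.
case: (pselect (indep x y)) => [xy|/(dependent_scale x0)[s ys]].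
  have [u1 [ux uy]] := indep_dual (-1) 0 xy; have [u2 [vx vy]] := indep_dual 0 (-1) xy.
  have [s [t []]] := indep_dual_span (dotp z x) (dotp z y) xy.
  set q := s *: x + t *: y => qx qy.
  have zq : z = q.
    apply/eqP; rewrite -subr_eq0 -dotp_eq0 eq_le dotp_ge0 andbT.
    have -> : dotp (z - q) (z - q) = dotp (z - q) z.
      by rewrite (dotpDr (z - q)) dotpNr {2}/q dotpDr !dotpZr !dotpDl !dotpNl qx qy !subrr !mulr0 addr0 subr0.
    by apply: H; rewrite dotpDl dotpNl ?qx ?qy subrr.
  exists s, t; split=> //.
      have := H u1; rewrite ux uy lerN10 lexx => /(_ isT isT).
    by rewrite zq /q dotpDr !dotpZr ux uy mulr0 addr0 mulrN1 oppr_le0.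
  have := H u2; rewrite vx vy lerN10 lexx => /(_ isT isT).
  by rewrite zq /q dotpDr !dotpZr vx vy mulr0 add0r mulrN1 oppr_le0.
(* Dependent generators: if the coefficient [q] along [x] is negative, testing with [- x] forces
   [s <= 0], and [z] is a nonnegative multiple of [y]. *)
pose q := dotp z x / dotp x x.
have zx : dotp (z - q *: x) x = 0 by rewrite !dotpE /q divfK ?subrr // gt_eqF.
have zq : z = q *: x.
  apply/eqP; rewrite -subr_eq0 -dotp_eq0 eq_le dotp_ge0 andbT.
  have -> : dotp (z - q *: x) (z - q *: x) = dotp (z - q *: x) z.
    by rewrite (dotpDr (z - q *: x)) dotpNr dotpZr zx mulr0 subr0.
  by apply: H; rewrite ?ys ?dotpZr zx ?mulr0.
have [q0|q0] := leP 0 q; first by exists q, 0; rewrite scale0r addr0.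
have [s0|s0] := leP s 0; last first.
  have := H (- x); rewrite ys zq !dotpNl !dotpZr !oppr_le0 (ltW xx).
  rewrite mulr_ge0 ?(ltW xx) ?(ltW s0) // => /(_ isT isT).
  by rewrite leNgt nmulr_rlt0 // xx.
have sn0 : s != 0 by apply: contra_neq y0 => s00; rewrite ys s00 scale0r.
exists 0, (q / s); split=> //; last by rewrite scale0r add0r ys scalerA divfK.
by rewrite mulr_le0 ?(ltW q0) // invr_le0.
Qed.

End DotProduct.

(** * Suprema of affine functions *)

Section EReal.
Variable R : realType.
Implicit Types e f : \bar R.

Lemma lee_real e f : (0 <= e)%E -> (0 <= f)%E ->
  (forall r : R, 0 < r -> (f <= r%:E)%E -> (e <= r%:E)%E) -> (e <= f)%E.
Proof.
case: f => [s| |] //= e0 s0 H; last by rewrite leey.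
apply/lee_addgt0Pr => d d0; rewrite -EFinD; apply: H.
  by rewrite ltr_wpDl.
by rewrite lee_fin lerDl ltW.
Qed.

Lemma ge0_ereal_real e : (0 <= e)%E -> e = +oo%E \/ exists2 r : R, 0 <= r & e = r%:E.
Proof. by case: e => [r| |] // r0; [right; exists r | left]. Qed.

Lemma lee_mul_real (a r : R) e : 0 < a -> ((a%:E * e <= r%:E) = (e <= (r / a)%:E))%E.
Proof.
move=> a0; case: e => [s| |].
- by rewrite -EFinM !lee_fin ler_pdivlMr // mulrC.
- by rewrite gt0_muley ?lte_fin.
- by rewrite gt0_muleNy ?lte_fin // !leNye.
Qed.

End EReal.

Section Cvx0.
Variables (R : realType) (n : nat).
Implicit Types (x y z u : 'cV[R]_n) (a b r s t : R) (f g h : cvx0 R n).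

Definition cle f g := forall x, (f x <= g x)%E.

Lemma cle_refl f : cle f f. Proof. by move=> x; exact: lexx. Qed.

Lemma cle_trans g f h : cle f g -> cle g h -> cle f h.
Proof. by move=> fg gh x; exact: le_trans (fg x) (gh x). Qed.

Lemma cle_anti f g : cle f g -> cle g f -> f = g.
Proof.
move=> fg gf; have : cvx0_fun f = cvx0_fun g.
  by apply/funext => x; apply/eqP; rewrite eq_le fg gf.
case: f g fg gf => f f1 f2 f3 f4 [g g1 g2 g3 g4] _ _ /= e.
rewrite e in f1 f2 f3 f4 *.
by congr Cvx0; exact: Prop_irrelevance.
Qed.

Lemma cleP f g : (forall x r, 0 < r -> (g x <= r%:E)%E -> (f x <= r%:E)%E) -> cle f g.
Proof. by move=> H x; apply: lee_real => [||r r0]; rewrite ?cvx0_ge0 //; exact: H. Qed.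

Lemma cvx0_real f x r : (f x <= r%:E)%E -> 0 <= r.
Proof. by move=> H; have := le_trans (cvx0_ge0 f x) H; rewrite lee_fin. Qed.

Lemma cvx0_conv f x y r s t : 0 <= t <= 1 -> (f x <= r%:E)%E -> (f y <= s%:E)%E ->
  (f (t *: x + (1 - t) *: y)%R <= (t * r + (1 - t) * s)%:E)%E.
Proof.
move=> t01 fr fs; apply: le_trans (@cvx0_convex _ _ f x y t t01) _.
case/andP: t01 => t0 t1.
by rewrite [leRHS]EFinD (EFinM t r) (EFinM (1 - t) s) leeD // lee_wpmul2l ?lee_fin ?subr_ge0.
Qed.

Lemma cvx0_scale f x r t : 0 <= t <= 1 -> (f x <= r%:E)%E -> (f (t *: x)%R <= (t * r)%:E)%E.
Proof.
move=> t01 fr; have f0 : (f 0%R <= 0%:E)%E by rewrite cvx0_at0.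
by have := cvx0_conv t01 fr f0; rewrite scaler0 mulr0 !addr0.
Qed.

Lemma econvexP (f : 'cV[R]_n -> \bar R) : (forall x, (0 <= f x)%E) ->
  (forall x y r s t, 0 <= t <= 1 -> (f x <= r%:E)%E -> (f y <= s%:E)%E ->
    (f (t *: x + (1 - t) *: y)%R <= (t * r + (1 - t) * s)%:E)%E) -> econvex f.
Proof.
move=> f0 H x y t t01; case/andP: (t01) => t0 t1.
have [->|tn0] := eqVneq t 0; first by rewrite scale0r add0r subr0 scale1r mul0e add0e mul1e.
have [->|tn1] := eqVneq t 1; first by rewrite scale1r subrr scale0r addr0 mul0e adde0 mul1e.
have tp : 0 < t by rewrite lt_def tn0.
have tp1 : 0 < 1 - t by rewrite subr_gt0 lt_def eq_sym tn1.
case: (ge0_ereal_real (f0 x)) => [->|[r r0 fx]].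
  rewrite gt0_muley ?lte_fin // addye ?leey // gt_eqF // (@lt_le_trans _ _ 0%E) ?ltNy0 //.
  by rewrite mule_ge0 // lee_fin ltW.
case: (ge0_ereal_real (f0 y)) => [->|[s s0 fy]].
  rewrite gt0_muley ?lte_fin // addey ?leey // gt_eqF // (@lt_le_trans _ _ 0%E) ?ltNy0 //.
  by rewrite mule_ge0 // lee_fin ltW.
by rewrite fx fy -!EFinM -EFinD; apply: H; rewrite ?fx ?fy.
Qed.

(* [(0, 0)] is always added, so that the supremum is nonnegative. *)
Definition supaff_set (P : 'cV[R]_n -> R -> Prop) u b :=
  (u = 0 /\ b = 0) \/ (0 <= b /\ P u b).

Definition supaff_fun (P : 'cV[R]_n -> R -> Prop) x : \bar R :=
  ereal_sup [set e | exists u b, supaff_set P u b /\ e = (dotp u x - b)%:E].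

Variable P : 'cV[R]_n -> R -> Prop.

Lemma supaff_fun_le x r : (supaff_fun P x <= r%:E)%E <->
  0 <= r /\ forall u b, 0 <= b -> P u b -> dotp u x - b <= r.
Proof.
split=> [H|[r0 H]].
  have Q u b : supaff_set P u b -> dotp u x - b <= r.
    by move=> Pub; rewrite -lee_fin; apply: le_trans H; apply: ereal_sup_ubound; exists u, b.
  split=> [|u b b0 Pub]; last by apply: Q; right.
  by have := @Q 0 0; rewrite dotp0l subr0; apply; left.
apply: ge_ereal_sup => e [u [b [[[-> ->]|[b0 Pub]] ->]]].
  by rewrite dotp0l subr0.
by rewrite lee_fin; exact: H.
Qed.

Lemma supaff_ge0 x : (0 <= supaff_fun P x)%E.
Proof.
apply: ereal_sup_ubound; exists 0, 0; rewrite dotp0l subr0; split=> //; by left.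
Qed.

Lemma supaff_at0 : supaff_fun P 0 = 0%E.
Proof.
apply/eqP; rewrite eq_le supaff_ge0 andbT; apply/supaff_fun_le; split=> // u b b0 _.
by rewrite dotp0r sub0r oppr_le0.
Qed.

Lemma supaff_convex : econvex (supaff_fun P).
Proof.
apply: econvexP => [|x y r s t /andP[t0 t1]]; first exact: supaff_ge0.
move=> /supaff_fun_le[r0 fr] /supaff_fun_le[s0 fs]; apply/supaff_fun_le; split.
  by rewrite addr_ge0 // mulr_ge0 // subr_ge0.
move=> u b b0 Pub; rewrite !dotpE.
have := fr _ _ b0 Pub; have := fs _ _ b0 Pub => A B.
have -> : t * dotp u x + (1 - t) * dotp u y - b =
  t * (dotp u x - b) + (1 - t) * (dotp u y - b) by ring.
by rewrite lerD // ler_wpM2l // subr_ge0.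
Qed.

Lemma supaff_lsc : lower_semicontinuous (supaff_fun P).
Proof.
move=> x a /ereal_sup_gt[_ [u [b [Pub ->]]]]; rewrite lte_fin => ax.
exists [set y | a < dotp u y - b].
  apply: open_nbhs_nbhs; split => //=.
  rewrite (_ : mkset _ = dotp u @^-1` [set r | r > a + b]); last first.
    by apply/seteqP; split=> y /=; rewrite ltrBrDr.
  apply: open_comp => // y _; exact: dotp_continuous.
by move=> y ay; apply: lt_le_trans (_ : (_ < (dotp u y - b)%:E)%E) _; rewrite ?lte_fin //;
  apply: ereal_sup_ubound; exists u, b.
Qed.

(** Every member of the class constructed below is such a supremum, so the axioms are verified only
    once. The condition [0 <= b] makes each affine function nonpositive at the origin. *)
Definition supaff := Cvx0 supaff_ge0 supaff_at0 supaff_convex supaff_lsc.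

Lemma supaff_le x r : (supaff x <= r%:E)%E <->
  0 <= r /\ forall u b, 0 <= b -> P u b -> dotp u x - b <= r.
Proof. exact: supaff_fun_le. Qed.

End Cvx0.

(** * Affine minorants *)

Section Minorants.
Variables (R : realType) (n : nat).
Implicit Types (x y z u p : 'cV[R]_n) (a b r s t w : R) (f g h : cvx0 R n).

Definition minorant f u b := 0 <= b /\ forall x, ((dotp u x - b)%:E <= f x)%E.

Lemma compact_box (M : R) : compact [set x : 'cV[R]_n | forall i, x i 0 \in `[- M, M]].
Proof.
have C : compact [set v : 'rV[R]_n | forall i, v 0 i \in `[- M, M]].
  by apply: (@rV_compact _ _ (fun=> `[(- M), M]%classic)) => _; exact: segment_compact.
have -> : [set x : 'cV[R]_n | forall i, x i 0 \in `[- M, M]] =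
    trmx @` [set v : 'rV[R]_n | forall i, v 0 i \in `[- M, M]].
  apply/seteqP; split=> [x xM|_ [v vM <-] i]; last by rewrite mxE.
  by exists x^T => [i|]; [rewrite mxE | rewrite trmxK].
apply: continuous_compact => //; apply: continuous_subspaceT.
move=> v A [P Pn PA]; exists (fun i j => P j i) => [i j|w Pw].
  by have := Pn j i; rewrite mxE.
by apply: PA => i j; rewrite mxE; exact: Pw.
Qed.

(** [m] is the minimum of [f + N |. - y|^2], attained at [p]. The quadratic term makes the
    near-minimising sets bounded, and lower semicontinuity shows that a cluster point of them
    attains the infimum. *)
Lemma lsc_minimizer f y N : 0 < N ->
  exists m p, (f p <= (m - N * dotp (p - y) (p - y))%:E)%E /\
    forall x r, (f x <= r%:E)%E -> m <= r + N * dotp (x - y) (x - y).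
Proof.
move=> N0; pose q x := N * dotp (x - y) (x - y).
have q_ge0 x : 0 <= q x by rewrite mulr_ge0 ?dotp_ge0 // ltW.
pose S := [set s | exists x, (f x <= (s - q x)%:E)%E].
have lS : lbound S 0.
  by move=> s [x /cvx0_real]; rewrite subr_ge0; exact: le_trans.
have S0 : S (q 0) by exists 0; rewrite cvx0_at0 subrr.
have infS : has_inf S by split; [exists (q 0) | exists 0].
pose F := filter_from [set e : R | 0 < e]
  (fun e => [set x | (f x <= (inf S + e - q x)%:E)%E]).
have FP : ProperFilter F.
  apply: filter_from_proper; first apply: filter_from_filter.
  - by exists 1 => /=.
  - move=> i j i0 j0; exists (Num.min i j); first by rewrite /= lt_min i0.
    move=> x /= H; split; apply: le_trans H _; rewrite lee_fin lerD2r lerD2l ge_min lexx ?orbT //.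
  - move=> e e0; have [s [x fx] se] := inf_adherent e0 infS.
    by exists x; apply: le_trans fx _; rewrite lee_fin lerD2r ltW.
(* [d ^+ 2 <= k] implies [d <= 1 + k], which spares a square root. *)
pose K := 1 + (inf S + 1) / N.
have qK x : q x <= inf S + 1 -> forall i, `|(x - y) i 0| <= K.
  move=> qx i; have d2 : ((x - y) i 0) ^+ 2 <= (inf S + 1) / N.
    by apply: le_trans (dotp_coord_le _ _) _; rewrite ler_pdivlMr // mulrC.
  rewrite /K; rewrite -(real_normK (num_real _)) in d2; have := normr_ge0 ((x - y) i 0).
  by move: d2; set d := `|_|; set k := _ / _; move=> *; nra.
pose M := K + `|y|.
have [p [_ clp]] : [set x : 'cV[R]_n | forall i, x i 0 \in `[- M, M]] `&` cluster F !=set0.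
  apply: compact_box; exists 1 => //= x /[dup] /cvx0_real; rewrite subr_ge0 => /qK qx _ i.
  rewrite in_itv /= -ler_norml.
  have -> : x i 0 = (x - y) i 0 + y i 0 by rewrite !mxE subrK.
  apply: le_trans (ler_normD _ _) _; rewrite lerD ?qx // [leRHS](_ : _ = mx_norm y) // mx_normrE.
  by apply/bigmax_geP; right => /=; exists (i, 0).
exists (inf S), p; split; last first.
  by move=> x r fx; apply: ge_inf; [exists 0 | exists x; rewrite addrK].
rewrite -/(q p) leNgt; apply/negP => lt_p.
have [d d0 fpd] : exists2 d, 0 < d & ((inf S - q p + d + d)%:E < f p)%E.
  case/ge0_ereal_real: (cvx0_ge0 f p) => [e|[s s0 e]]; rewrite e in lt_p *.
    by exists 1; rewrite ?ltry.
  rewrite lte_fin in lt_p; exists ((s - (inf S - q p)) / 3); last rewrite lte_fin; lra.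
have [V pV Vf] := @cvx0_lsc _ _ f p _ fpd.
have qc : nbhs p [set x | q p - d < q x].
  have qE x : q x = N * (dotp x x - 2 * dotp y x + dotp y y).
    by rewrite /q !dotpE (dotpC x y); ring.
  have dxx : continuous (fun x : 'cV[R]_n => dotp x x).
    move=> x; have FF : Filter (nbhs x) by exact: nbhs_filter.
    rewrite /dotp; apply: (@cvg_big R _ +%R 0 xpredT add_continuous) => i _.
    by apply: cvgM; exact: coord_continuous.
  have : continuous q.
    rewrite (_ : q = (fun x => N * (dotp x x - 2 * dotp y x + dotp y y))); last exact/funext.
    move=> x; have FF : Filter (nbhs x) by exact: nbhs_filter.
    apply: cvgM; first exact: cvg_cst.
    apply: cvgD; last exact: cvg_cst.
    apply: cvgB; first exact: dxx.
    by apply: cvgM; [exact: cvg_cst | exact: dotp_continuous].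
  move=> qcont; apply: open_nbhs_nbhs; split => /=; last by rewrite gtrBl.
  rewrite (_ : mkset _ = q @^-1` [set r | r > q p - d]) //.
  by apply: open_comp => // x _; exact: qcont.
have [x [/= fx [Vx qx]]] : [set x | (f x <= (inf S + d - q x)%:E)%E] `&`
    (V `&` [set x | q p - d < q x]) !=set0.
  by apply: clp; [exists d | exact: filterI].
have := lt_le_trans (Vf _ Vx) fx; rewrite lte_fin; lra.
Qed.

(* The minimizer of [f + N |. - y|^2] carries a subgradient of [f], and the resulting affine minorant
   exceeds [w] at [y] as soon as [N] is large. *)
Lemma minorant_exists f y w : 0 <= w -> ~ (f y <= w%:E)%E ->
  exists u b, minorant f u b /\ w < dotp u y - b.
Proof.
move=> w0 /negP; rewrite -ltNge => fy.
have [V + Vf] := @cvx0_lsc _ _ f y _ fy.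
rewrite -nbhs_ballE => -[e /= e0 eV].
have far x : (f x <= w%:E)%E -> e ^+ 2 <= dotp (x - y) (x - y).
  move=> fx; rewrite leNgt; apply/negP => xy.
  have : V x.
    apply: eV; split=> // i j; rewrite (ord1 j) /ball /= ltNge; apply/negP => H.
    have : e ^+ 2 <= `|y i 0 - x i 0| ^+ 2 by rewrite lerXn2r ?nnegrE // ltW.
    rewrite real_normK ?num_real //.
    by have := dotp_coord_le (x - y) i; rewrite !mxE; move: xy; set X := dotp _ _; nra.
  by move/Vf; rewrite ltNge fx.
have e2 : 0 < e ^+ 2 by rewrite exprn_gt0.
(* Chosen with [N * e ^+ 2 = w + 1]: a minimiser outside the ball then costs more than [w]. *)
pose N := (w + 1) / e ^+ 2.
have N0 : 0 < N by rewrite divr_gt0 // ltr_wpDl.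
have [m [p [fp mE]]] := lsc_minimizer f y N0.
set q := dotp (p - y) (p - y) in fp.
have q0 : 0 <= q by exact: dotp_ge0.
have wm : w < m.
  rewrite ltNge; apply/negP => mw.
  have mq := cvx0_real fp.
  have : (f p <= w%:E)%E by apply: le_trans fp _; rewrite lee_fin; nra.
  move/far; rewrite -/q => qe.
  have : N * e ^+ 2 <= N * q by rewrite ler_wpM2l // ltW.
  by rewrite /N divfK ?gt_eqF // -/N; lra.
set fp' := m - N * q in fp; pose u := (2 * N) *: (y - p).
have key x r : (f x <= r%:E)%E -> dotp u x - (dotp u p - fp') <= r.
  move=> fx; pose X := dotp (x - p) (x - p).
  have X0 : 0 <= X by exact: dotp_ge0.
  have -> : dotp u x - (dotp u p - fp') = fp' + dotp u (x - p) by rewrite dotpDr dotpNr; ring.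
  (* First-order condition: minimality tested at [t *: x + (1 - t) *: p] and divided by [t]. The
     remainder [t * (N * X)] disappears as [t] tends to 0. *)
  have S t : 0 < t -> t <= 1 -> 0 <= r - fp' - dotp u (x - p) + t * (N * X).
    move=> t0 t1; have t01 : 0 <= t <= 1 by rewrite ltW.
    have := mE _ _ (cvx0_conv t01 fx fp).
    have -> : t *: x + (1 - t) *: p - y = (p - y) + t *: (x - p).
      rewrite scalerBl scale1r scalerBr; set A := t *: x; set B := t *: p.
      by rewrite addrAC [RHS]addrAC addrC [A - B]addrC -!addrA; congr (_ + _); rewrite addrC !addrA addrC addrA.
    have -> : dotp (p - y + t *: (x - p)) (p - y + t *: (x - p)) =
        q + 2 * t * dotp (p - y) (x - p) + t ^+ 2 * X.
      by rewrite dotpDl !(dotpDr _ (p - y)) !dotpZl !dotpZr (dotpC (x - p)) -/q -/X; ring.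
    have -> : dotp u (x - p) = - (2 * N * dotp (p - y) (x - p)).
      by rewrite /u -(opprB p y) dotpZl dotpNl mulrN.
    rewrite {1}(_ : m = fp' + N * q); last by rewrite /fp'; ring.
    set G := dotp _ _ => H.
    have : 0 <= t * (r - fp' - - (2 * N * G) + t * (N * X)) by move: H; nra.
    by rewrite pmulr_rge0.
  have NX : 0 <= N * X by rewrite mulr_ge0 // ltW.
  apply/ler_addgt0Pr => d d0.
  pose t := Num.min 1 (d / (N * X + 1)).
  have NX1 : 0 < N * X + 1 by lra.
  have t0 : 0 < t by rewrite lt_min ltr01 divr_gt0.
  have t1 : t <= 1 by rewrite ge_min lexx.
  have td : t * (N * X + 1) <= d by rewrite -ler_pdivlMr // ge_min lexx orbT.
  by have := S _ t0 t1; nra.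
exists u, (dotp u p - fp'); split; first split.
- by have := key 0 0; rewrite cvx0_at0 dotp0r sub0r oppr_le0; exact.
- move=> x; case/ge0_ereal_real: (cvx0_ge0 f x) => [->|[r _ e']]; first exact: leey.
  by rewrite e' lee_fin; apply: key; rewrite e'.
have -> : dotp u y - (dotp u p - fp') = fp' + dotp u (y - p) by rewrite dotpDr dotpNr; ring.
rewrite /u dotpZl -(opprB p y) dotpNl dotpNr opprK -/q /fp'.
by have : 0 <= N * q by [rewrite mulr_ge0 // ltW]; lra.
Qed.

(** Fenchel-Moreau for this class: by [minorant_exists], affine minorants with [0 <= b] suffice to
    recover the function. *)
Lemma cvx0_leP f x r : (f x <= r%:E)%E <->
  0 <= r /\ forall u b, minorant f u b -> dotp u x - b <= r.
Proof.
split=> [fx|[r0 H]].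
  split; first exact: cvx0_real fx.
  by move=> u b [_ /(_ x) ub]; have := le_trans ub fx; rewrite lee_fin.
apply: contrapT => /(minorant_exists r0)[u [b [/H + lt]]].
by rewrite leNgt lt.
Qed.

End Minorants.

(** * Rays, segments and triangle functions *)

Section Elements.
Variables (R : realType) (n : nat).
Implicit Types (x y z u p : 'cV[R]_n) (a b c r s t w : R) (f g h : cvx0 R n).

(* [hplus u b] is the positive part of [<u, .> - b]. The functions [delta], [ray z], [seg z] are the
   indicators (0 inside, +oo outside) of {0}, of the ray through [z] and of the segment [0, z];
   [lin z] maps [t *: z] to [t] for [t >= 0], [tri z c] maps [t *: z] to [t * c] for [0 <= t <= 1], and
   both are +oo elsewhere. In particular [f <= tri z c] means [f z <= c], see [cle_triP]. *)
Definition hplus u b := supaff (fun v c => v = u /\ c = b).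
Definition delta : cvx0 R n := supaff (fun _ _ => True).
Definition ray z := supaff (fun u _ => dotp u z <= 0).
Definition seg z := supaff (fun u b => dotp u z <= b).
Definition lin z := supaff (fun u _ => dotp u z <= 1).
Definition tri z c := supaff (fun u b => dotp u z - b <= c).
Definition cmax f g := supaff (fun u b => minorant f u b \/ minorant g u b).
(** The function [a * f] for [a > 0]: its affine minorants are [a] times those of [f]. *)
Definition csc a f := supaff (fun u b => minorant f (a^-1 *: u) (a^-1 * b)).

Definition indicator f := forall x r, (f x <= r%:E)%E -> (f x <= 0%:E)%E.

Lemma hplus_le u b x r : 0 <= b -> (hplus u b x <= r%:E)%E <-> 0 <= r /\ dotp u x - b <= r.
Proof.
move=> b0; split=> [/supaff_le[r0 H]|[r0 H]]; first by split=> //; exact: H.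
by apply/supaff_le; split=> // v c _ [-> ->].
Qed.

Lemma minorant_hplus u b : 0 <= b -> minorant (hplus u b) u b.
Proof.
move=> b0; split=> // x.
case/ge0_ereal_real: (cvx0_ge0 (hplus u b) x) => [->|[r r0 e]]; first exact: leey.
by have : (hplus u b x <= r%:E)%E; [rewrite e | move/(hplus_le _ _ _ b0)=> [_ H]; rewrite e lee_fin].
Qed.

Lemma hplus_cle f u b : 0 <= b ->
  (forall x r, (f x <= r%:E)%E -> dotp u x - b <= r) -> cle (hplus u b) f.
Proof.
move=> b0 H; apply: cleP => x r r0 /H fx; apply/hplus_le => //; split=> //; exact: ltW.
Qed.

Lemma minorantP f u b : minorant f u b <-> 0 <= b /\ cle (hplus u b) f.
Proof.
split=> [[b0 H]|[b0 H]]; split=> // x.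
  apply: hplus_cle => // {}x r fx; rewrite -lee_fin; exact: le_trans (H x) fx.
exact: le_trans ((minorant_hplus u b0).2 x) (H x).
Qed.

Lemma cle_supaff f (P : 'cV[R]_n -> R -> Prop) :
  (forall u b, minorant f u b -> P u b) -> cle f (supaff P).
Proof.
move=> H; apply: cleP => x r r0 /supaff_le[_ fx].
by apply/cvx0_leP; split=> [|u b /[dup] -[b0 _] /H]; [exact: ltW | exact: fx].
Qed.

Lemma cvx0_ray_mono f z (m p : R) r : 0 <= m <= p -> (f (p *: z) <= r%:E)%E -> (f (m *: z) <= r%:E)%E.
Proof.
move=> /andP[m0 mp] fp; have r0 := cvx0_real fp.
have [p0|pn0] := eqVneq p 0.
  have -> : m = 0 by apply/eqP; rewrite eq_le m0 andbT -p0.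
  by rewrite scale0r cvx0_at0 lee_fin.
have pp : 0 < p by rewrite lt_def pn0 (le_trans m0 mp).
have T : 0 <= m / p <= 1 by rewrite divr_ge0 ?(ltW pp) //= ler_pdivrMr ?mul1r.
have := cvx0_scale T fp; rewrite scalerA divfK // => h; apply: le_trans h _.
by rewrite lee_fin ler_piMl //; case/andP: T.
Qed.

Lemma cmax_le f g x r : (cmax f g x <= r%:E)%E <-> (f x <= r%:E)%E /\ (g x <= r%:E)%E.
Proof.
split=> [/supaff_le[r0 H]|[/cvx0_leP[r0 fx] /cvx0_leP[_ gx]]].
  by split; apply/cvx0_leP; split=> // u b /[dup] -[b0 _] ub; apply: H => //; [left|right].
by apply/supaff_le; split=> // u b b0 [/fx|/gx].
Qed.

Lemma cmax_l f g : cle f (cmax f g).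
Proof. by apply: cleP => x r _ /cmax_le[]. Qed.

Lemma cmax_r f g : cle g (cmax f g).
Proof. by apply: cleP => x r _ /cmax_le[]. Qed.

Lemma cmax_lub f g h : cle f h -> cle g h -> cle (cmax f g) h.
Proof.
move=> fh gh; apply: cleP => x r _ hx; apply/cmax_le.
by split; [exact: le_trans (fh x) hx | exact: le_trans (gh x) hx].
Qed.

Lemma csc_le a f x r : 0 < a -> (csc a f x <= r%:E)%E <-> (f x <= (r / a)%:E)%E.
Proof.
move=> a0; split=> [/supaff_le[r0 H]|/cvx0_leP[r0 fx]].
  apply/cvx0_leP; split=> [|u b ub]; first by rewrite divr_ge0 // ltW.
  rewrite ler_pdivlMr // mulrC mulrBr -dotpZl; apply: H.
    by rewrite mulr_ge0 ?ub.1 // ltW.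
  by rewrite scalerA mulrA mulVf ?gt_eqF // scale1r mul1r.
have r1 : 0 <= r by move: r0; rewrite pmulr_lge0 // invr_gt0.
apply/supaff_le; split=> // u b b0 /fx.
by rewrite dotpZl -mulrBr mulrC ler_pM2r // invr_gt0.
Qed.

Lemma cscK a f x r : 0 < a -> (csc a f x <= (a * r)%:E)%E <-> (f x <= r%:E)%E.
Proof. by move=> a0; rewrite csc_le // mulrAC divff ?gt_eqF // mul1r. Qed.

Lemma csc_cle a f g : 0 < a -> cle f g -> cle (csc a f) (csc a g).
Proof.
move=> a0 fg; apply: cleP => x r _ /(csc_le _ _ _ a0) gx; apply/csc_le => //.
exact: le_trans (fg x) gx.
Qed.

Lemma csc_csc a b f : 0 < a -> 0 < b -> csc a (csc b f) = csc (a * b) f.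
Proof.
move=> a0 b0; have ab := mulr_gt0 a0 b0.
by apply: cle_anti; apply: cleP => x r _; rewrite !csc_le // invfM !mulrA mulrAC.
Qed.

Lemma csc1 f : csc 1 f = f.
Proof. by apply: cle_anti; apply: cleP => x r _; rewrite csc_le // divr1. Qed.

Lemma csc_indicator a f : 0 < a -> indicator f -> csc a f = f.
Proof.
move=> a0 If; apply: cle_anti; apply: cleP => x r r0.
  move/If => fx; apply/csc_le => //; apply: le_trans fx _.
  by rewrite lee_fin divr_ge0 // ltW.
by move/(csc_le _ _ _ a0)/If => fx; apply: le_trans fx _; rewrite lee_fin ltW.
Qed.

Lemma delta_le x r : (delta x <= r%:E)%E -> x = 0.
Proof.
move=> /supaff_le[r0 H]; apply/eqP; rewrite -dotp_eq0 eq_le dotp_ge0 andbT leNgt; apply/negP => x0.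
have := H (((r + 1) / dotp x x) *: x) 0 (lexx _) I.
by rewrite dotpZl divfK ?gt_eqF // subr0 gerDl ler10.
Qed.

Lemma cle_delta f : cle f delta.
Proof. by apply: cle_supaff. Qed.

Lemma delta_indicator : indicator delta.
Proof. by move=> x r /delta_le ->; rewrite cvx0_at0. Qed.

Lemma neq_deltaP f : f <> delta <-> exists x r, x != 0 /\ (f x <= r%:E)%E.
Proof.
split=> [H|[x [r [x0 fx]]] fd]; last by move: fx; rewrite fd => /delta_le/eqP; rewrite (negPf x0).
apply: contrapT => H'; apply: H; apply: cle_anti; first exact: cle_delta.
apply: cleP => x r r0 fx; case: (eqVneq x 0) => [->|x0].
  by rewrite cvx0_at0 lee_fin ltW.
by exfalso; apply: H'; exists x, r.
Qed.

Lemma cle_rayP f z : cle f (ray z) <-> forall t, 0 <= t -> (f (t *: z) <= 0%:E)%E.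
Proof.
split=> [H t t0|H]; last first.
  apply: cle_supaff => u b [b0 ub]; rewrite leNgt; apply/negP => uz.
  have T : 0 <= (b + 1) / dotp u z by rewrite divr_ge0 ?addr_ge0 // ltW.
  have := le_trans (ub _) (H _ T); rewrite lee_fin dotpZr divfK ?gt_eqF //.
  by rewrite addrAC subrr add0r ler10.
apply: le_trans (H _) _; apply/supaff_le; split=> // u b b0 uz.
by rewrite dotpZr subr_le0 (le_trans _ b0) // mulr_ge0_le0.
Qed.

Lemma cle_triP f z c : 0 <= c -> cle f (tri z c) <-> (f z <= c%:E)%E.
Proof.
move=> c0; split=> [H|/cvx0_leP[_ H]]; last exact: cle_supaff.
by apply: le_trans (H z) _; apply/supaff_le.
Qed.

Lemma cle_segP f z : cle f (seg z) <-> (f z <= 0%:E)%E.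
Proof.
split=> [H|/cvx0_leP[_ H]]; last by apply: cle_supaff => u b /H; rewrite subr_le0.
by apply: le_trans (H z) _; apply/supaff_le; split=> // u b b0; rewrite subr_le0.
Qed.

(** An affine minorant whose slope along [z] exceeds 1 overtakes [t] eventually; the witness is the
    [t] with [t * (dotp u z - 1) = b + 1]. *)
Lemma cle_linP f z : cle f (lin z) <-> forall t, 0 <= t -> (f (t *: z) <= t%:E)%E.
Proof.
split=> [H t t0|H]; last first.
  apply: cle_supaff => u b [b0 ub]; rewrite leNgt; apply/negP => uz.
  have d : 0 < dotp u z - 1 by rewrite subr_gt0.
  have T : 0 <= (b + 1) / (dotp u z - 1) by rewrite divr_ge0 ?(ltW d) ?addr_ge0.
  have := le_trans (ub _) (H _ T); rewrite lee_fin dotpZr -lerBDr opprK => {}H.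
  have : (b + 1) / (dotp u z - 1) * (dotp u z - 1) <= b.
    by rewrite mulrBr mulr1; move: H; lra.
  by rewrite divfK ?gt_eqF // gerDl ler10.
apply: le_trans (H _) _; apply/supaff_le; split=> // u b b0 uz.
by rewrite dotpZr lerBlDr; have := ler_wpM2l t0 uz; rewrite mulr1; lra.
Qed.

Lemma ray_val z t : 0 <= t -> (ray z (t *: z) <= 0%:E)%E.
Proof. by move=> t0; exact: ((cle_rayP _ _).1 (cle_refl _)). Qed.

Lemma lin_val z t : 0 <= t -> (lin z (t *: z) <= t%:E)%E.
Proof. by move=> t0; exact: ((cle_linP _ _).1 (cle_refl _)). Qed.

Lemma tri_val z c t : 0 <= c -> 0 <= t <= 1 -> (tri z c (t *: z) <= (t * c)%:E)%E.
Proof. by move=> c0 t01; apply: cvx0_scale => //; apply/(cle_triP _ _ c0); exact: cle_refl. Qed.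

Lemma seg_val z t : 0 <= t <= 1 -> (seg z (t *: z) <= 0%:E)%E.
Proof.
move=> t01; rewrite -[0](mulr0 t); apply: cvx0_scale => //.
by apply/cle_segP; exact: cle_refl.
Qed.

(** Functionals nonpositive at [z] can be scaled at will, so a finite value at [x] excludes both a
    component orthogonal to [z] and a negative coefficient along [z]. The multiples used are those
    reaching the value [r + 1]. *)
Lemma ray_inv z x r : z != 0 -> (ray z x <= r%:E)%E -> exists2 t, 0 <= t & x = t *: z.
Proof.
move=> z0 /supaff_le[r0 H]; have zz : 0 < dotp z z by rewrite dotp_gt0.
pose p := dotp x z / dotp z z.
have pz : dotp (x - p *: z) z = 0 by rewrite !dotpE /p divfK ?subrr // gt_eqF.
have xp : x = p *: z.
  apply/eqP; rewrite -subr_eq0 -dotp_eq0 eq_le dotp_ge0 andbT leNgt; apply/negP => d.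
  have := H (((r + 1) / dotp (x - p *: z) (x - p *: z)) *: (x - p *: z)) 0 (lexx _).
  rewrite !dotpZl pz mulr0 lexx => /(_ isT).
  have -> : dotp (x - p *: z) x = dotp (x - p *: z) (x - p *: z).
    by rewrite [in RHS]dotpDr dotpNr dotpZr pz mulr0 subr0.
  by rewrite divfK ?gt_eqF // subr0 gerDl ler10.
exists p => //; rewrite leNgt; apply/negP => p0.
have := H (((r + 1) / (p * dotp z z)) *: z) 0 (lexx _).
have d0 : p * dotp z z < 0 by rewrite nmulr_rlt0.
rewrite {1}xp !dotpZl dotpZr subr0.
have -> : (r + 1) / (p * dotp z z) * (p * dotp z z) = r + 1 by rewrite divfK // lt_eqF.
rewrite gerDl ler10.
rewrite nmulr_rle0 ?dotp_ge0 ?(ltW zz) => [/(_ isT)//|].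
by rewrite nmulr_llt0 ?invr_lt0 // ltr_wpDl.
Qed.

Lemma ray_seg z : cle (ray z) (seg z).
Proof. by apply/cle_segP; have := @ray_val z 1 ler01; rewrite scale1r. Qed.

Lemma ray_tri z c : 0 <= c -> cle (ray z) (tri z c).
Proof.
move=> c0; apply/cle_triP => //; have := @ray_val z 1 ler01; rewrite scale1r => H.
exact: le_trans H _.
Qed.

Lemma ray_lin z : cle (ray z) (lin z).
Proof. by apply/cle_linP => t t0; apply: le_trans (ray_val z t0) _. Qed.

Lemma seg_tri z c : 0 <= c -> cle (seg z) (tri z c).
Proof.
by move=> c0; apply/cle_triP => //; have := @seg_val z 1; rewrite scale1r ler01 lexx => /(_ isT) H;
  apply: le_trans H _.
Qed.

Lemma lin_tri z c : 0 < c -> cle (lin (c^-1 *: z)) (tri z c).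
Proof.
move=> c0; apply/cle_triP; first exact: ltW.
by have := lin_val (c^-1 *: z) (ltW c0); rewrite scalerA divff ?gt_eqF // scale1r.
Qed.

Lemma lin_inv z x r : z != 0 -> (lin z x <= r%:E)%E -> exists t, [/\ 0 <= t, t <= r & x = t *: z].
Proof.
move=> z0 H; have [t t0 xt] := ray_inv z0 (le_trans (ray_lin z x) H).
exists t; split=> //; move: H; rewrite xt => /supaff_le[r0 H].
have := H ((dotp z z)^-1 *: z) 0 (lexx _).
by rewrite dotpZl dotpZr dotpZl mulVf ?dotp_eq0 // mulr1 subr0; exact.
Qed.

Lemma seg_inv z x r : z != 0 -> (seg z x <= r%:E)%E -> exists2 t, 0 <= t <= 1 & x = t *: z.
Proof.
move=> z0 H; have [t t0 xt] := ray_inv z0 (le_trans (ray_seg z x) H).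
exists t => //; move: H; rewrite xt t0 => /supaff_le[r0 H].
rewrite leNgt; apply/negP => t1; have t10 : 0 < t - 1 by rewrite subr_gt0.
have k0 : 0 <= (r + 1) / (t - 1) by rewrite divr_ge0 ?(ltW t10) ?addr_ge0.
have := H (((r + 1) / (t - 1)) *: ((dotp z z)^-1 *: z)) _ k0.
rewrite !dotpZl dotpZr mulVf ?dotp_eq0 // mulr1 lexx => /(_ isT).
set k := (r + 1) / (t - 1); rewrite -/k.
have -> : k * ((dotp z z)^-1 * (t * dotp z z)) - k = k * (t - 1).
  by field; rewrite dotp_eq0.
rewrite divfK ?gt_eqF //.
by rewrite gerDl ler10.
Qed.

Lemma tri_inv z c x r : z != 0 -> 0 <= c -> (tri z c x <= r%:E)%E ->
  exists t, [/\ 0 <= t <= 1, t * c <= r & x = t *: z].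
Proof.
move=> z0 c0 H; have [t t01 xt] := seg_inv z0 (le_trans (seg_tri z c0 x) H).
exists t; split=> //; move: c0; rewrite le_eqVlt => /predU1P[<-|c0].
  by rewrite mulr0 (cvx0_real H).
have cz : c^-1 *: z != 0 by rewrite scaler_eq0 (negPf z0) invr_eq0 gt_eqF.
have [s [s0 sr e]] := lin_inv cz (le_trans (lin_tri z c0 x) H).
suff -> : t * c = s by [].
by move: e; rewrite xt scalerA => /(scaler_inj z0) ->; rewrite divfK // gt_eqF.
Qed.

Lemma ray_indicator z : indicator (ray z).
Proof.
have [->|z0] := eqVneq z 0; last by move=> x r /(ray_inv z0)[t t0 ->]; exact: ray_val.
have -> : ray 0 = delta; last exact: delta_indicator.
apply: cle_anti; first exact: cle_delta.
by apply: cle_supaff => u b _; rewrite dotp0r.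
Qed.

Lemma seg0 : seg 0 = delta.
Proof.
apply: cle_anti; first exact: cle_delta.
by apply: cle_supaff => u b [b0 _]; rewrite dotp0r.
Qed.

Lemma lin0 : lin 0 = delta.
Proof.
apply: cle_anti; first exact: cle_delta.
by apply: cle_supaff => u b [b0 _]; rewrite dotp0r ler01.
Qed.

Lemma seg_indicator z : indicator (seg z).
Proof.
have [->|z0] := eqVneq z 0; first by rewrite seg0; exact: delta_indicator.
by move=> x r /(seg_inv z0)[t t0 ->]; exact: seg_val.
Qed.

Lemma seg_neq_delta z : z != 0 -> seg z <> delta.
Proof.
move=> z0; apply/neq_deltaP; exists z, 0; split=> //.
by apply/cle_segP; exact: cle_refl.
Qed.

Lemma lin_neq_delta z : z != 0 -> lin z <> delta.
Proof.
move=> z0; apply/neq_deltaP; exists z, 1; split=> //.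
by have := @lin_val z 1 ler01; rewrite scale1r.
Qed.

Lemma ray_neq_delta z : z != 0 -> ray z <> delta.
Proof.
move=> z0; apply/neq_deltaP; exists z, 0; split=> //.
by have := @ray_val z 1 ler01; rewrite scale1r.
Qed.

Lemma rayZ z t : 0 < t -> ray (t *: z) = ray z.
Proof.
move=> t0; apply: cle_anti; apply/cle_rayP => s s0.
  have -> : s *: z = (s / t) *: (t *: z) by rewrite scalerA divfK ?gt_eqF.
  apply: ray_val.
  by rewrite divr_ge0 // ltW.
by rewrite scalerA; apply: ray_val; rewrite mulr_ge0 // ltW.
Qed.

Lemma ray_le_scale y z : y != 0 -> z != 0 -> cle (ray y) (ray z) ->
  exists2 t, 0 < t & z = t *: y.
Proof.
move=> y0 z0 /cle_rayP/(_ 1 ler01); rewrite scale1r => /(ray_inv y0)[t t0 e].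
exists t => //; rewrite lt_def t0 andbT; apply: contra_neq z0 => t00.
by rewrite e t00 scale0r.
Qed.

Lemma ray_le_eq y z : y != 0 -> z != 0 -> cle (ray y) (ray z) -> ray y = ray z.
Proof. by move=> y0 z0 /(ray_le_scale y0 z0)[t t0 ->]; rewrite rayZ. Qed.

Lemma seg_cle_ge f z : z != 0 -> cle (ray z) f ->
  (forall t r, 1 < t -> ~ (f (t *: z) <= r%:E)%E) -> cle (seg z) f.
Proof.
move=> z0 zf H; apply: cleP => x r r0 fx.
have [t t0 e] := ray_inv z0 (le_trans (zf x) fx).
have [t1|t1] := leP t 1; last by case: (H t r t1); rewrite -e.
by rewrite e; apply: le_trans (_ : (_ <= 0%:E)%E) _; [apply: seg_val; rewrite t0 | rewrite lee_fin ltW].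
Qed.

Lemma tri_cle_ge f z c : z != 0 -> 0 <= c -> cle (seg z) f ->
  (forall t r, 0 <= t <= 1 -> (f (t *: z) <= r%:E)%E -> t * c <= r) -> cle (tri z c) f.
Proof.
move=> z0 c0 zf H; apply: cleP => x r r0 fx.
have [t t01 e] := seg_inv z0 (le_trans (zf x) fx).
by rewrite e; apply: le_trans (tri_val z c0 t01) _; rewrite lee_fin; apply: H => //; rewrite -e.
Qed.

(** Together with [seg_tri] and [lin_tri], this makes [tri z c] the maximum of [seg z] and
    [lin (c^-1 *: z)]. *)
Lemma tri_cle_max f z c : z != 0 -> 0 < c -> cle (seg z) f -> cle (lin (c^-1 *: z)) f ->
  cle (tri z c) f.
Proof.
move=> z0 c0 sf lf; apply: tri_cle_ge => //; first exact: ltW.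
move=> t r /andP[t0 t1] fx.
have cz : c^-1 *: z != 0 by rewrite scaler_eq0 (negPf z0) invr_eq0 gt_eqF.
have [s [s0 sr e]] := lin_inv cz (le_trans (lf _) fx).
suff -> : t * c = s by [].
by move: e; rewrite scalerA => /(scaler_inj z0) ->; rewrite divfK // gt_eqF.
Qed.

Lemma hplus_seg u b z : 0 <= b -> cle (hplus u b) (seg z) <-> dotp u z <= b.
Proof.
move=> b0; rewrite cle_segP hplus_le //; split=> [[_]|H]; rewrite subr_le0 //.
Qed.

Lemma hplus_ray u b z : 0 <= b -> dotp u z <= 0 -> cle (hplus u b) (ray z).
Proof.
move=> b0 uz; apply/cle_rayP => t t0; apply/hplus_le => //; split=> //.
by rewrite dotpZr subr_le0 (le_trans _ b0) // mulr_ge0_le0.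
Qed.

Lemma hplus_lin u b z : 0 <= b -> cle (hplus u b) (lin z) <-> dotp u z <= 1.
Proof.
move=> b0; split=> H.
  rewrite leNgt; apply/negP => uz; have d : 0 < dotp u z - 1 by rewrite subr_gt0.
  have T : 0 <= (b + 1) / (dotp u z - 1) by rewrite divr_ge0 ?(ltW d) ?addr_ge0.
  have /(_ _ T)/(hplus_le _ _ _ b0)[_] := (cle_linP _ _).1 H.
  rewrite dotpZr => {}H.
  have : (b + 1) / (dotp u z - 1) * (dotp u z - 1) <= b.
    by rewrite mulrBr mulr1; move: H; lra.
  by rewrite divfK ?gt_eqF // gerDl ler10.
apply/cle_linP => t t0; apply/hplus_le => //; split=> //.
by rewrite dotpZr lerBlDr; have := ler_wpM2l t0 H; rewrite mulr1; lra.
Qed.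

End Elements.
Arguments delta {R n}.

(** * Almost order isomorphisms *)

Section AlmostIso.
Variables (R : realType) (n : nat).
Implicit Types (x y z u p : 'cV[R]_n) (a b c r s t w : R) (f g h F : cvx0 R n).

(** The order preserving counterpart of [almost_order_reversing], with the constant always written
    as a multiplier [a] instead of [a^-1]. *)
Definition almost_mono a (S : cvx0 R n -> cvx0 R n) :=
  (forall f g, cle f g -> cle (S f) (csc a (S g))) /\
  (forall f g, cle (csc a f) g -> cle (S f) (S g)).

Definition almost_iso a S S' :=
  [/\ 1 < a, almost_mono a S, almost_mono a S', cancel S S' & cancel S' S].

Lemma almost_iso_sym a S S' : almost_iso a S S' -> almost_iso a S' S.
Proof. by case. Qed.

(* [csc a] fixes [{0, +oo}]-valued functions, so comparisons with them survive the loss of a factor [a]. *)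
Lemma indicator_cle_csc a f g : 0 < a -> indicator f -> cle f (csc a g) -> cle f g.
Proof.
move=> a0 If fg; apply: cleP => x r r0 gx.
apply: le_trans (_ : (_ <= 0%:E)%E) _; last by rewrite lee_fin ltW.
by apply: (If _ (a * r)); apply: le_trans (fg x) _; apply/cscK.
Qed.

Lemma almost_iso_ind a S S' f g : almost_iso a S S' -> indicator f ->
  (cle f g <-> cle (S f) (S g)) /\ (cle g f <-> cle (S g) (S f)).
Proof.
move=> [a1 [_ S2] [T1 _] K _] If; have a0 : 0 < a by exact: lt_trans a1.
split; split=> H.
- by apply: S2; rewrite csc_indicator.
- by move: (T1 _ _ H); rewrite !K; exact: indicator_cle_csc.
- by apply: S2; move: (csc_cle a0 H); rewrite (csc_indicator a0 If).
- by move: (T1 _ _ H); rewrite !K (csc_indicator a0 If).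
Qed.

(** Serves for [lin z], which is no indicator itself but may have one as its image. *)
Lemma almost_iso_ind' a S S' f g : almost_iso a S S' -> indicator (S f) ->
  (cle f g <-> cle (S f) (S g)) /\ (cle g f <-> cle (S g) (S f)).
Proof.
move=> H If; have [a1 _ _ K _] := H.
have [A B] := @almost_iso_ind a S' S (S f) (S g) (almost_iso_sym H) If.
by rewrite !K in A B; split; split; by [case: A | case: B].
Qed.

Lemma almost_iso_delta a S S' : almost_iso a S S' -> S delta = delta.
Proof.
move=> H; apply: cle_anti; first exact: cle_delta.
rewrite -{1}(let: And5 _ _ _ _ K := H in K delta).
by apply: (almost_iso_ind _ H (@delta_indicator _ _)).2.1; exact: cle_delta.
Qed.

Lemma almost_iso_neq_delta a S S' f : almost_iso a S S' -> f <> delta -> S f <> delta.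
Proof.
move=> H fd; rewrite -(almost_iso_delta H) => /(congr1 S').
by case: H => _ _ _ K _; rewrite !K.
Qed.

Lemma cmax_ray_delta y z : y != 0 -> z != 0 -> ~ (ray z y <= 0%:E)%E ->
  cmax (ray y) (ray z) = delta.
Proof.
move=> y0 z0 yz; apply: contrapT => /neq_deltaP[x [r [x0 /cmax_le[yx zx]]]]; apply: yz.
have [t t0 e] := ray_inv y0 yx; have [s s0 e'] := ray_inv z0 zx.
have tp : 0 < t by rewrite lt_def t0 andbT; apply: contra_neq x0 => t00; rewrite e t00 scale0r.
have -> : y = (t^-1 * s) *: z by rewrite -scalerA -e' e scalerA mulVf ?gt_eqF ?scale1r.
by apply: ray_val; rewrite mulr_ge0 ?invr_ge0.
Qed.

(** Recognises, by order alone, the functions that are finite on a single ray. If [f] were finite at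
    [x] and [z] on different rays, its restrictions to these rays would be two functions above [f],
    neither equal to [delta], with maximum [delta]. *)
Lemma ray_criterion f : f <> delta ->
  (forall g h, cle f g -> cle f h -> g <> delta -> h <> delta -> cmax g h <> delta) ->
  exists2 z, z != 0 & cle (ray z) f.
Proof.
move=> /neq_deltaP[z [r [z0 fz]]] H; exists z => //.
apply: cleP => x s s0 fx.
case: (eqVneq x 0) => [->|x0]; first by rewrite cvx0_at0 lee_fin ltW.
apply: contrapT => zx.
have raynd y q : y != 0 -> (f y <= q%:E)%E -> cmax f (ray y) <> delta.
  move=> y0 fy; apply/neq_deltaP; exists y, q; split=> //; apply/cmax_le; split=> //.
  have := @ray_val _ _ y 1 ler01; rewrite scale1r => h; apply: le_trans h _.
  by rewrite lee_fin (cvx0_real fy).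
have := H _ _ (cmax_l f (ray x)) (cmax_l f (ray z)) (raynd _ _ x0 fx) (raynd _ _ z0 fz).
apply; apply: cle_anti; first exact: cle_delta.
rewrite -(@cmax_ray_delta x z) //; last by move=> h; apply: zx; apply: le_trans h _; rewrite lee_fin ltW.
by apply: cmax_lub; [apply: cle_trans (cmax_l _ _) | apply: cle_trans (cmax_r _ _)]; exact: cmax_r.
Qed.

Lemma ray_of_ray z f g : z != 0 -> cle (ray z) f -> cle (ray z) g ->
  f <> delta -> g <> delta -> cmax f g <> delta.
Proof.
move=> z0 zf zg /neq_deltaP[x [r [x0 fx]]] /neq_deltaP[y [s [y0 gy]]].
have [p p0 ex] := ray_inv z0 (le_trans (zf x) fx).
have [q q0 ey] := ray_inv z0 (le_trans (zg y) gy).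
have pp : 0 < p by rewrite lt_def p0 andbT; apply: contra_neq x0 => p00; rewrite ex p00 scale0r.
have qp : 0 < q by rewrite lt_def q0 andbT; apply: contra_neq y0 => q00; rewrite ey q00 scale0r.
have r0 := cvx0_real fx; have s0 := cvx0_real gy.
rewrite ex in fx; rewrite ey in gy.
pose m := Num.min p q; have m0 : 0 < m by rewrite lt_min pp.
have mp : 0 <= m <= p by rewrite ltW //= ge_min lexx.
have mq : 0 <= m <= q by rewrite ltW //= ge_min lexx orbT.
apply/neq_deltaP; exists (m *: z), (r + s); split; first by rewrite scaler_eq0 (negPf z0) gt_eqF.
by apply/cmax_le; split; [apply: le_trans (cvx0_ray_mono mp fx) _ | apply: le_trans (cvx0_ray_mono mq gy) _];
  rewrite lee_fin ?lerDl ?lerDr.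
Qed.

(** The criterion survives the loss of a factor because being different from [delta] does. It gives
    only an inequality; applying it to [S'] too, and using that comparable rays coincide, gives the
    equality. *)
Lemma almost_iso_ray a S S' z : almost_iso a S S' -> z != 0 ->
  exists2 y, y != 0 & S (ray z) = ray y.
Proof.
suff half T T' x : almost_iso a T T' -> x != 0 -> exists2 y, y != 0 & cle (ray y) (T (ray x)).
  move=> H z0; have [y y0 yz] := half _ _ _ H z0.
  have [x x0 xy] := half _ _ _ (almost_iso_sym H) y0.
  exists y => //; have [_ _ _ K K'] := H.
  have yz' : cle (S' (ray y)) (ray z).
    rewrite -[ray z]K.
    by apply: (almost_iso_ind _ (almost_iso_sym H) (@ray_indicator _ _ _)).1.1.
  have e := ray_le_eq x0 z0 (cle_trans xy yz').
  have -> : ray z = S' (ray y) by apply: cle_anti => //; rewrite -e.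
  by rewrite K'.
move=> H x0; have [a1 [T1 T2] [U1 U2] K K'] := H; have a0 : 0 < a by exact: lt_trans a1.
apply: ray_criterion; first exact: almost_iso_neq_delta H (ray_neq_delta x0).
have up g : cle (T (ray x)) g -> cle (ray x) (T' (csc a g)).
  by move=> xg; rewrite -[ray x]K; apply: U2; exact: csc_cle.
have nd g : g <> delta -> T' (csc a g) <> delta.
  move=> /neq_deltaP[y [r [y0 gy]]]; apply: almost_iso_neq_delta (almost_iso_sym H) _.
  by apply/neq_deltaP; exists y, (a * r); split=> //; apply/cscK.
move=> g h xg xh gd hd.
have M := ray_of_ray x0 (up _ xg) (up _ xh) (nd _ gd) (nd _ hd).
have down k : cle (T' (csc a k)) (cmax (T' (csc a g)) (T' (csc a h))) ->
    cle k (T (cmax (T' (csc a g)) (T' (csc a h)))).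
  move=> /T1; rewrite K' => le; apply: cleP => y r r0 /(cscK _ _ _ a0) le1.
  by apply/(cscK _ _ _ a0); exact: le_trans (le y) le1.
move=> ghd; have : T (cmax (T' (csc a g)) (T' (csc a h))) = delta.
  apply: cle_anti; first exact: cle_delta.
  by rewrite -ghd; apply: cmax_lub; apply: down; [exact: cmax_l | exact: cmax_r].
exact: almost_iso_neq_delta H M.
Qed.

End AlmostIso.

(** * Primeness for max and min, and the images of segments *)

Section SegmentImages.
Variables (R : realType) (n : nat).
Implicit Types (x y z u p : 'cV[R]_n) (a b c r s t w : R) (f g h k F : cvx0 R n).

(** For functions above [ray z], lying above [seg z] means being +oo beyond [z]. If [S' g] and
    [S' h] are both finite somewhere beyond [z], their maximum is finite at the nearer of the two
    points. *)
Lemma almost_iso_max_prime a S S' z y g h : almost_iso a S S' -> z != 0 ->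
  S (ray z) = ray y -> cle (ray y) g -> cle (ray y) h ->
  cle (S (seg z)) (cmax g h) -> cle (S (seg z)) g \/ cle (S (seg z)) h.
Proof.
move=> H z0 Sz yg yh gh; have [a1 [S1 S2] [T1 T2] K K'] := H.
have a0 : 0 < a by exact: lt_trans a1.
pose M := cmax (S' g) (S' h).
have onray k : cle (ray y) k -> cle (ray z) (S' k).
  by move=> yk; apply: (almost_iso_ind _ H (@ray_indicator _ _ _)).1.2; rewrite Sz K'.
have up k : cle (S' k) M -> cle k (S (csc a M)).
  by move=> kM; rewrite -[k]K'; apply: S2; exact: csc_cle.
have zM : cle (seg z) M.
  apply: indicator_cle_csc (@seg_indicator _ _ _) _; first exact: a0.
  apply: (almost_iso_ind _ H (@seg_indicator _ _ _)).1.2; apply: cle_trans gh _.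
  by apply: cmax_lub; apply: up; [exact: cmax_l | exact: cmax_r].
have out k : cle (ray y) k -> ~ cle (S (seg z)) k ->
    exists t r, 1 < t /\ (S' k (t *: z) <= r%:E)%E.
  move=> /onray yk nk; apply: contrapT => nex; apply: nk.
  rewrite -[k]K'; apply: (almost_iso_ind _ H (@seg_indicator _ _ _)).1.1.
  by apply: seg_cle_ge => // t r t1 fx; apply: nex; exists t, r.
apply: contrapT => /not_orP[/(out _ yg)[t [r [t1 gt]]] /(out _ yh)[s [q [s1 hs]]]].
pose m := Num.min t s; have m1 : 1 < m by rewrite lt_min t1.
have m0 : 0 <= m by apply: le_trans (ltW m1).
have mt : 0 <= m <= t by rewrite m0 ge_min lexx.
have ms : 0 <= m <= s by rewrite m0 ge_min lexx orbT.
have : (M (m *: z) <= (r + q)%:E)%E.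
  have r0 := cvx0_real gt; have q0 := cvx0_real hs.
  by apply/cmax_le; split; [apply: le_trans (cvx0_ray_mono mt gt) _ | apply: le_trans (cvx0_ray_mono ms hs) _];
    rewrite lee_fin ?lerDl ?lerDr.
move=> /(le_trans (zM _))/(seg_inv z0)[p /andP[_ p1]] /(scaler_inj z0) mp.
by move: m1; rewrite mp ltNge p1.
Qed.

(** A pointwise minimum need not be convex, hence the hypothesis on all common lower bounds [k]. If
    [S' g] and [S' h] are both positive at [z], they have a common lower bound [m] positive at [z],
    and the image of [csc a^-1 m] is a [k] violating the hypothesis. *)
Lemma almost_iso_min_prime a S S' z y g h : almost_iso a S S' -> z != 0 ->
  S (ray z) = ray y -> cle (ray y) g -> cle (ray y) h ->
  (forall k, cle k g -> cle k h -> cle k (S (seg z))) ->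
  cle g (S (seg z)) \/ cle h (S (seg z)).
Proof.
move=> H z0 Sz yg yh gh; have [a1 [S1 S2] [T1 T2] K K'] := H.
have a0 : 0 < a by exact: lt_trans a1.
have zz : 0 < dotp z z by rewrite dotp_gt0.
have onray k : cle (ray y) k -> cle (ray z) (S' k).
  by move=> yk; apply: (almost_iso_ind _ H (@ray_indicator _ _ _)).1.2; rewrite Sz K'.
have out k : ~ cle k (S (seg z)) -> exists u b, minorant (S' k) u b /\ 0 < dotp u z - b.
  move=> nk; apply: minorant_exists => // kz; apply: nk; rewrite -[k]K'.
  by apply: (almost_iso_ind _ H (@seg_indicator _ _ _)).2.1; apply/cle_segP.
apply: contrapT => /not_orP[/out[u1 [b1 [[b10 m1] p1]]] /out[u2 [b2 [[b20 m2] p2]]]].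
set a1' := dotp u1 z in p1; set a2' := dotp u2 z in p2.
have a10 : 0 < a1' by lra. have a20 : 0 < a2' by lra.
(* At [t *: z] with [t >= r], both minorants are at least [s * (t - r)]: [r] is the larger of their
   zeros, [s] the smaller of their slopes. *)
pose r := Num.max (b1 / a1') (b2 / a2'); pose s := Num.min a1' a2'.
have r0 : 0 <= r by rewrite le_max divr_ge0 // ltW.
have r1 : r < 1 by rewrite gt_max !ltr_pdivrMr // !mul1r -subr_gt0 p1 -subr_gt0.
have s0 : 0 < s by rewrite lt_min a10.
have sr0 : 0 <= s * r by rewrite mulr_ge0 // ltW.
pose m := hplus ((s / dotp z z) *: z) (s * r).
have below k u b : cle (ray y) k -> (forall x, ((dotp u x - b)%:E <= S' k x)%E) ->
    s <= dotp u z -> b <= r * dotp u z -> cle m (S' k).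
  move=> yk ub su br; apply: hplus_cle => // x q kx.
  have [t t0 e] := ray_inv z0 (le_trans (onray _ yk x) kx).
  have q0 := cvx0_real kx; have := le_trans (ub _) kx.
  rewrite e lee_fin !dotpZl !dotpZr mulrCA divfK ?gt_eqF // => le1.
  have [tr|rt] := leP t r; last by nra.
  by apply: le_trans q0; rewrite subr_le0 mulrC ler_pM2l.
have mg : cle m (S' g).
  by apply: below m1 _ _ => //; rewrite ?ge_min ?lexx // -ler_pdivrMr // le_max lexx.
have mh : cle m (S' h).
  by apply: below m2 _ _ => //; rewrite ?ge_min ?lexx ?orbT // -ler_pdivrMr // le_max lexx orbT.
have sub k : cle m (S' k) -> cle (S (csc a^-1 m)) k.
  move=> mk; rewrite -[k]K'; apply: S2.
  by rewrite csc_csc ?invr_gt0 // divff ?gt_eqF // csc1.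
have := gh _ (sub _ mg) (sub _ mh) => /(almost_iso_ind _ H (@seg_indicator _ _ _)).2.2.
move=> /cle_segP; rewrite -(mulr0 a^-1) cscK ?invr_gt0 // hplus_le // => -[_].
rewrite dotpZl divfK ?gt_eqF // -{1}[s]mulr1 -mulrBr pmulr_rle0 // subr_le0.
by rewrite leNgt r1.
Qed.

(** A minorant that exceeds the bound at [t] already exceeds it at [s], the midpoint of [t] and the
    crossing point [b / d]. *)
Lemma ray_limit F y (k : R) t : 0 <= k -> 0 < t ->
  (forall s, 0 <= s -> s < t -> (F (s *: y) <= (s * k)%:E)%E) -> (F (t *: y) <= (t * k)%:E)%E.
Proof.
move=> k0 t0 H; apply/cvx0_leP; split=> [|u b [b0 ub]]; first by rewrite mulr_ge0 // ltW.
rewrite dotpZr leNgt; apply/negP => lt1; pose d := dotp u y - k.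
have td : b < t * d by rewrite mulrBr; lra.
have d0 : 0 < d by rewrite -(pmulr_rgt0 _ t0); exact: le_lt_trans td.
pose s := (t + b / d) / 2.
have bd : b / d < t by rewrite ltr_pdivrMr.
have bd0 : 0 <= b / d by rewrite divr_ge0 // ltW.
have s0 : 0 <= s by rewrite /s; lra.
have st : s < t by rewrite /s; lra.
have := le_trans (ub _) (H _ s0 st); rewrite lee_fin dotpZr => le1.
have : s * d <= b by rewrite mulrBr; lra.
by rewrite -ler_pdivlMr // /s; lra.
Qed.

(** The supremum is the end of the effective domain on the ray. Nothing is claimed at the end
    itself, which is left to [ray_limit]. *)
Lemma ray_end F y t0 b : 0 < t0 -> (exists r, (F (t0 *: y) <= r%:E)%E) -> 0 <= b ->
  (forall r, ~ (F (b *: y) <= r%:E)%E) ->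
  exists2 t, 0 < t & (forall s, 0 <= s -> s < t -> exists r, (F (s *: y) <= r%:E)%E) /\
    (forall s r, t < s -> ~ (F (s *: y) <= r%:E)%E).
Proof.
move=> t00 fin b0 inf; pose T := [set t | 0 <= t /\ exists r, (F (t *: y) <= r%:E)%E].
have T0 : T t0 by split=> //; exact: ltW.
have ubT : ubound T b.
  move=> t [t1 [r ft]]; rewrite leNgt; apply/negP => bt; apply: (inf r).
  by apply: cvx0_ray_mono ft; rewrite b0 ltW.
have sT : has_sup T by split; [exists t0 | exists b].
have le_sup t : T t -> t <= sup T by move=> Tt; apply: ub_le_sup Tt; exists b.
exists (sup T); first exact: lt_le_trans (le_sup _ T0).
split=> [s s0 st|s r st fs]; last first.
  have : T s.
    by split; [apply: le_trans (ltW st); apply: le_trans (le_sup _ T0); exact: ltW | exists r].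
  by move/le_sup; rewrite leNgt st.
have d : 0 < sup T - s by rewrite subr_gt0.
have [t [t1 [r ft]]] := sup_adherent d sT; rewrite opprB addrC subrK => lt1.
by exists r; apply: cvx0_ray_mono ft; rewrite s0 ltW.
Qed.

Lemma ray_finite F z : z != 0 -> cle (ray z) F -> F <> delta ->
  exists2 t, 0 < t & exists r, (F (t *: z) <= r%:E)%E.
Proof.
move=> z0 zF /neq_deltaP[x [r [x0 fx]]]; have [t t0 e] := ray_inv z0 (le_trans (zF x) fx).
exists t; last by exists r; rewrite -e.
by rewrite lt_def t0 andbT; apply: contra_neq x0 => t00; rewrite e t00 scale0r.
Qed.

Lemma indicator_seg F z : z != 0 -> cle (ray z) F -> F <> delta -> F <> ray z ->
  indicator F -> exists2 t, 0 < t & F = seg (t *: z).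
Proof.
move=> z0 zF Fd Fz IF.
have [b b0 inf] : exists2 b, 0 <= b & forall r, ~ (F (b *: z) <= r%:E)%E.
  apply: contrapT => nex; apply: Fz; apply: cle_anti => //.
  apply/cle_rayP => t t0; apply: contrapT => nf; apply: nex; exists t => // r fr.
  by apply: nf; exact: IF fr.
have [t0 t00 fin] := ray_finite z0 zF Fd; have [t tp [ft1 ft2]] := ray_end t00 fin b0 inf.
exists t => //; apply: cle_anti.
  apply/cle_segP; rewrite -(mulr0 t); apply: ray_limit => // s s0 /(ft1 _ s0)[r fr].
  by rewrite mulr0; exact: IF fr.
apply: seg_cle_ge; [by rewrite scaler_eq0 (negPf z0) gt_eqF | by rewrite rayZ | move=> s r s1].
by rewrite scalerA; apply: ft2; rewrite ltr_pMl.
Qed.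

(* For [w] on the ray with [0 < F w < +oo], apply min-primeness to the restriction of [F] to [0, w] and
   to the function obtained from [F] by replacing it on [0, w] with the linear interpolation. *)
Lemma prime_seg_or_lin F z : z != 0 -> cle (ray z) F -> F <> delta -> F <> ray z ->
  (forall g h, cle (ray z) g -> cle (ray z) h -> cle F (cmax g h) -> cle F g \/ cle F h) ->
  (forall g h, cle (ray z) g -> cle (ray z) h ->
     (forall k, cle k g -> cle k h -> cle k F) -> cle g F \/ cle h F) ->
  exists2 t, 0 < t & F = seg (t *: z) \/ F = lin (t *: z).
Proof.
move=> z0 zF Fd Fz maxp minp.
have zt t : 0 < t -> t *: z != 0 by move=> t0; rewrite scaler_eq0 (negPf z0) gt_eqF.
case: (pselect (indicator F)) => [/(indicator_seg z0 zF Fd Fz)[t t0 ->]|nIF].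
  by exists t => //; left.
have [x [r [fx nf0]]] : exists x r, (F x <= r%:E)%E /\ ~ (F x <= 0%:E)%E.
  apply: contrapT => nex; apply: nIF => x r fx; apply: contrapT => nf.
  by apply: nex; exists x, r.
have [p p0 ex] := ray_inv z0 (le_trans (zF x) fx).
have pp : 0 < p.
  rewrite lt_def p0 andbT; apply/eqP => p00; apply: nf0.
  by rewrite ex p00 scale0r cvx0_at0.
have [c fc cp] : exists2 c, F x = c%:E & 0 < c.
  case: (ge0_ereal_real (cvx0_ge0 F x)) => [e|[c c0 e]]; first by rewrite e in fx.
  exists c => //; rewrite lt_def c0 andbT; apply/eqP => c00; apply: nf0.
  by rewrite e c00.
(* If [F] meets [lin y] at [d *: y], then [lin y] lies below [F]. Beyond that point this is
   convexity; before it, convexity gives the opposite inequality, and min-primeness is what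
   decides. *)
have step q d : 0 < q -> 0 < d -> F ((q * d) *: z) = d%:E -> cle (lin (q *: z)) F.
  move=> q0 d0; rewrite mulrC -scalerA; set y := q *: z => fq.
  have y0 : y != 0 by exact: zt.
  have ry : ray y = ray z by rewrite rayZ.
  have v0 : d *: y != 0 by rewrite scaler_eq0 (negPf y0) gt_eqF.
  have fle : (F (d *: y) <= d%:E)%E by rewrite fq.
  case: (minp (cmax F (seg (d *: y))) (cmax F (lin y))).
  - exact: cle_trans zF (cmax_l _ _).
  - exact: cle_trans zF (cmax_l _ _).
  - move=> k kg kh; apply: cleP => x' s s0 fy.
    have [t t0 ey] : exists2 t, 0 <= t & x' = t *: (d *: y).
      by apply: ray_inv v0 _; rewrite rayZ // ry; exact: le_trans (zF x') fy.
    have [t1|t1] := leP t 1.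
      apply: le_trans (kg x') _; apply/cmax_le; split=> //; rewrite ey.
      by apply: le_trans (seg_val _ _) _; rewrite ?t0 // lee_fin ltW.
    apply: le_trans (kh x') _; apply/cmax_le; split=> //.
    rewrite ey scalerA; apply: le_trans (lin_val _ _) _; first by rewrite mulr_ge0 // ltW.
    have tp : 0 < t by exact: lt_trans t1.
    have T : 0 <= t^-1 <= 1 by rewrite invr_ge0 (ltW tp) invf_le1 // ltW.
    have := cvx0_scale T fy; rewrite ey (scalerA t^-1 t) mulVf ?gt_eqF // scale1r fq lee_fin.
    by rewrite mulrC ler_pdivlMr // mulrC lee_fin.
  (* The restriction to [0, [d *: y]] cannot lie below [F]: convexity puts [F] below the maximum of
     [seg (d *: y)] and [lin y], so max-primeness would give [F (d *: y) <= 0] or a finite value of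
     [F] beyond [d *: y]. *)
  - move=> gF; exfalso; case: (maxp (seg (d *: y)) (lin y)).
    + by rewrite -ry -(rayZ y d0); exact: ray_seg.
    + by rewrite -ry; exact: ray_lin.
    + apply: cleP => x' s s0 /cmax_le[/(seg_inv v0)[t t01 ey] ly].
      rewrite ey; apply: le_trans (cvx0_scale t01 fle) _.
      move: ly; rewrite ey scalerA => /(lin_inv y0)[t' [_ t's]] /(scaler_inj y0) ->.
      by rewrite lee_fin.
    + by move=> /cle_segP; rewrite fq lee_fin leNgt d0.
    + move=> Fl; have : (cmax F (seg (d *: y)) (2 *: (d *: y)) <= (2 * d)%:E)%E.
        apply: le_trans (gF _) _; apply: le_trans (Fl _) _; rewrite scalerA.
        by apply: lin_val; rewrite mulr_ge0 // ltW.
      move=> /cmax_le[_ /(seg_inv v0)[t /andP[_ t1]]] /(scaler_inj v0) e2.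
      by move: t1; rewrite -e2; lra.
  - by move=> hF; exact: cle_trans (cmax_r _ _) hF.
pose q := p / c; have q0 : 0 < q by rewrite divr_gt0.
exists q => //; right; set y := q *: z.
have y0 : y != 0 by exact: zt.
have ry : ray y = ray z by rewrite rayZ.
have xcy : x = c *: y by rewrite ex scalerA /q mulrC divfK ?gt_eqF.
have lF : cle (lin y) F by apply: (step _ c) => //; rewrite /q divfK ?gt_eqF // -ex.
have fx' : (F (c *: y) <= c%:E)%E by rewrite -xcy fc.
(* Up to [c] this is convexity. Beyond, [step] at [t] bounds [F (c *: y)] below by [c * d / t],
   which forces [d <= t]. *)
have finle t : 0 <= t -> (exists r, (F (t *: y) <= r%:E)%E) -> (F (t *: y) <= t%:E)%E.
  move=> t0 [s fs]; have [tc|ct] := leP t c.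
    have T : 0 <= t / c <= 1 by rewrite divr_ge0 ?(ltW cp) //= ler_pdivrMr ?mul1r.
    by have := cvx0_scale T fx'; rewrite scalerA divfK ?gt_eqF.
  have tp : 0 < t by exact: lt_trans ct.
  case: (ge0_ereal_real (cvx0_ge0 F (t *: y))) => [e|[d d0 e]]; first by rewrite e in fs.
  have ft : (F (t *: y) <= d%:E)%E by rewrite e.
  have td : t <= d.
    by have [t' [_ t'd]] := lin_inv y0 (le_trans (lF _) ft) => /(scaler_inj y0) ->.
  have dp : 0 < d by exact: lt_le_trans td.
  have tq : 0 < t * q / d by rewrite divr_gt0 // mulr_gt0.
  have lt' : cle (lin ((t * q / d) *: z)) F.
    by apply: (step _ d) => //; rewrite divfK ?gt_eqF // -scalerA.
  have := le_trans (lt' _) fx'.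
  have -> : c *: y = (c * d / t) *: ((t * q / d) *: z).
    by rewrite /y !scalerA; congr (_ *: _); field; rewrite !gt_eqF.
  move=> /(lin_inv (zt _ tq))[t' [_ t'c]] /(scaler_inj (zt _ tq)) t'e.
  rewrite e lee_fin; move: t'c; rewrite -t'e ler_pdivrMr // ler_pM2l //.
apply: cle_anti => //.
case: (pselect (exists2 b, 0 <= b & forall r, ~ (F (b *: y) <= r%:E)%E)) => [[b b0 inf]|nex]; last first.
  apply/cle_linP => t t0; apply: finle => //; apply: contrapT => nf; apply: nex.
  by exists t => // s fs; apply: nf; exists s.
have [t tp [ft1 ft2]] := ray_end cp (ex_intro (fun r => (F (c *: y) <= r%:E)%E : Prop) c fx') b0 inf.
have ft : (F (t *: y) <= t%:E)%E.
  rewrite -{2}[t]mulr1; apply: ray_limit => // s s0 st; rewrite mulr1.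
  by apply: finle => //; exact: ft1.
have v0 : t *: y != 0 by rewrite scaler_eq0 (negPf y0) gt_eqF.
(* When the domain ends at [t *: y], [F] lies below the maximum of [seg (t *: y)] and [lin y]. It is
   positive at [t *: y], so max-primeness leaves only [F <= lin y]. *)
case: (maxp (seg (t *: y)) (lin y)) => //.
- by rewrite -ry -(rayZ y tp); exact: ray_seg.
- by rewrite -ry; exact: ray_lin.
- apply: cleP => x' s s0 /cmax_le[/(seg_inv v0)[t' t01 ey] ly].
  rewrite ey; apply: le_trans (cvx0_scale t01 ft) _.
  move: ly; rewrite ey scalerA => /(lin_inv y0)[t'' [_ t's]] /(scaler_inj y0) ->.
  by rewrite lee_fin.
- move=> /cle_segP f0; exfalso.
  have [t' [_ t'd]] := lin_inv y0 (le_trans (lF _) f0) => /(scaler_inj y0) e.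
  by move: tp; rewrite e ltNge t'd.
Qed.

Lemma almost_iso_seg a S S' z : almost_iso a S S' -> z != 0 ->
  exists y, [/\ y != 0, S (ray z) = ray y & S (seg z) = seg y \/ S (seg z) = lin y].
Proof.
move=> H z0; have [y y0 Sz] := almost_iso_ray H z0.
have [] := @prime_seg_or_lin (S (seg z)) y y0.
- rewrite -Sz; apply: (almost_iso_ind _ H (@ray_indicator _ _ _)).1.1; exact: ray_seg.
- exact: almost_iso_neq_delta H (seg_neq_delta z0).
- rewrite -Sz => /(congr1 S'); case: H => _ _ _ K _; rewrite !K => e.
  have : (ray z (2 *: z) <= 0%:E)%E by apply: ray_val.
  rewrite -e => /(seg_inv z0)[t /andP[_ t1]] /(scaler_inj z0) e2.
  by move: t1; rewrite -e2; lra.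
- by move=> g h; apply: (almost_iso_max_prime H).
- by move=> g h; apply: (almost_iso_min_prime H).
move=> t t0 e; exists (t *: y); split=> //; last by rewrite rayZ.
by rewrite scaler_eq0 (negPf y0) gt_eqF.
Qed.

End SegmentImages.

(** * The two kinds of directions *)

Section Types.
Variables (R : realType) (n : nat).
Implicit Types (x y z u v p : 'cV[R]_n) (a b c r s t w : R) (f g h k F : cvx0 R n).
Implicit Types (S : cvx0 R n -> cvx0 R n).

Lemma ray_eq_scale y z : y != 0 -> z != 0 -> ray y = ray z -> exists2 t, 0 < t & z = t *: y.
Proof. by move=> y0 z0 e; apply: ray_le_scale => //; rewrite e; exact: cle_refl. Qed.

Lemma lin_not_cle_seg y z : y != 0 -> z != 0 -> ~ cle (lin y) (seg z).
Proof.
move=> y0 z0 /cle_segP/(lin_inv y0)[t [t0 t0' e]].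
by move: z0; rewrite e (_ : t = 0) ?scale0r ?eqxx //; apply/eqP; rewrite eq_le t0'.
Qed.

Lemma seg_not_cle_lin y z : y != 0 -> z != 0 -> ~ cle (seg y) (lin z).
Proof.
move=> y0 z0 /cle_linP H.
have [t /andP[t0 t1] e] := seg_inv y0 (H 1 ler01).
have tp : 0 < t.
  rewrite lt_def t0 andbT; apply: contra_neq z0 => t00.
  by rewrite -[z]scale1r e t00 scale0r.
have p : 0 <= 2 / t by rewrite divr_ge0.
have [s /andP[s0 s1]] := seg_inv y0 (H _ p).
rewrite -[z]scale1r e scalerA divfK ?gt_eqF // => /(scaler_inj y0) e2.
by move: s1; rewrite -e2; lra.
Qed.

Definition is_ind S z := exists y, [/\ y != 0, S (ray z) = ray y & S (seg z) = seg y].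
Definition is_lin S z := exists y, [/\ y != 0, S (ray z) = ray y & S (seg z) = lin y].

Lemma ind_or_lin a S S' z : almost_iso a S S' -> z != 0 -> is_ind S z \/ is_lin S z.
Proof. by move=> H z0; have [y [y0 Sz [e|e]]] := almost_iso_seg H z0; [left|right]; exists y. Qed.

Lemma ind_not_lin S z : is_ind S z -> ~ is_lin S z.
Proof.
move=> [y [y0 _ e]] [x [x0 _]]; rewrite e => e'.
by apply: (@lin_not_cle_seg x y) => //; rewrite e'; exact: cle_refl.
Qed.

(** [seg z] and [seg (t *: z)] are comparable, hence so are their images, whereas a [seg] and a
    [lin] of nonzero vectors never are. *)
Lemma ind_scale a S S' z t : almost_iso a S S' -> z != 0 -> 0 < t -> is_ind S z -> is_ind S (t *: z).
Proof.
move=> H z0 t0 [y [y0 _ e]].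
have tz0 : t *: z != 0 by rewrite scaler_eq0 (negPf z0) gt_eqF.
case: (ind_or_lin H tz0) => // -[x [x0 _ e']]; exfalso.
have [t1|t1] := leP t 1.
  apply: (@seg_not_cle_lin y x) => //; rewrite -e -e'.
  apply: (almost_iso_ind _ H (@seg_indicator _ _ _)).1.1.
  by apply/cle_segP; apply: seg_val; rewrite t1 ltW.
apply: (@lin_not_cle_seg x y) => //; rewrite -e -e'.
apply: (almost_iso_ind _ H (@seg_indicator _ _ _)).1.1.
have T : 0 <= t^-1 <= 1 by rewrite invr_ge0 (ltW t0) invf_le1 // ltW.
by apply/cle_segP; have := seg_val (t *: z) T; rewrite scalerA mulVf ?gt_eqF // scale1r.
Qed.

Lemma lin_scale a S S' z t : almost_iso a S S' -> z != 0 -> 0 < t -> is_lin S z -> is_lin S (t *: z).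
Proof.
move=> H z0 t0 lz; have tz0 : t *: z != 0 by rewrite scaler_eq0 (negPf z0) gt_eqF.
case: (ind_or_lin H tz0) => // iz; have ti : 0 < t^-1 by rewrite invr_gt0.
have := ind_scale H tz0 ti iz; rewrite scalerA mulVf ?gt_eqF // scale1r.
by move/ind_not_lin.
Qed.

Lemma ind_inv a S S' z : almost_iso a S S' -> z != 0 -> is_ind S z ->
  exists y, [/\ y != 0, S (ray z) = ray y, S (seg z) = seg y & is_ind S' y].
Proof.
move=> [_ _ _ K _] z0 [y [y0 e e']]; exists y; split=> //.
by exists z; rewrite -e -e' !K.
Qed.

Lemma lin_inv_type a S S' z y : almost_iso a S S' -> z != 0 -> y != 0 ->
  S (ray z) = ray y -> is_lin S z -> is_lin S' y.
Proof.
move=> H z0 y0 Sz lz; case: (ind_or_lin (almost_iso_sym H) y0) => // -[x [x0 e e']]; exfalso.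
have [_ _ _ K K'] := H.
have xz : ray x = ray z by rewrite -e -Sz K.
have [t t0 zx] := ray_eq_scale x0 z0 xz.
have ix : is_ind S x by exists y; rewrite -e -e' !K'.
by have := ind_scale H x0 t0 ix; rewrite -zx => /ind_not_lin.
Qed.

(** If [u] is nonpositive at [y1] and [y2], the preimage of [hplus u 0] vanishes on the rays of [z1]
    and [z2], hence by convexity on that of [z1 + z2]; so [u] is nonpositive at [y3] and [farkas2]
    applies. Injectivity of [S] on rays excludes the degenerate positions. *)
Lemma rays_cone a S S' z1 z2 y1 y2 y3 : almost_iso a S S' -> indep z1 z2 ->
  y1 != 0 -> y2 != 0 -> y3 != 0 ->
  S (ray z1) = ray y1 -> S (ray z2) = ray y2 -> S (ray (z1 + z2)) = ray y3 ->
  indep y1 y2 /\ exists b c, [/\ 0 < b, 0 < c & y3 = b *: y1 + c *: y2].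
Proof.
move=> H z12 y10 y20 y30 e1 e2 e3; have [_ _ _ K K'] := H.
have ind z := @ray_indicator R n z.
have [b [c [b0 c0 e]]] : exists b c, [/\ 0 <= b, 0 <= c & y3 = b *: y1 + c *: y2].
  apply: farkas2 => // u u1 u2.
  have up y z : dotp u y <= 0 -> S (ray z) = ray y -> cle (S' (hplus u 0)) (ray z).
    move=> uy ez; apply: (almost_iso_ind _ H (ind z)).2.2; rewrite K' ez.
    exact: hplus_ray.
  have z3 : cle (S' (hplus u 0)) (ray (z1 + z2)).
    have := up _ _ u1 e1; have := up _ _ u2 e2 => /cle_rayP h2 /cle_rayP h1.
    apply/cle_rayP => t t0.
    have p : 0 <= (2^-1 : R) <= 1 by lra.
    have t2 : 0 <= 2 * t by rewrite mulr_ge0.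
    have := cvx0_conv p (h1 _ t2) (h2 _ t2).
    rewrite !scalerA !mulr0 addr0 (_ : (1 - 2^-1) * (2 * t) = t); last by field.
    by rewrite mulKf // -scalerDr.
  have := (almost_iso_ind _ H (ind _)).2.1 z3; rewrite K' e3 => /cle_rayP/(_ 1 ler01).
  by rewrite scale1r hplus_le // subr0 => -[].
have r13 : ray z1 <> ray (z1 + z2).
  move=> e'; have z10 := indep_neq0 z12.
  have [t _ et] : exists2 t, 0 <= t & z1 + z2 = t *: z1.
    apply: ray_inv z10 _; rewrite e'; have := @ray_val _ _ (z1 + z2) 1 ler01.
    by rewrite scale1r; exact.
  have e0 : (1 - t) *: z1 + 1 *: z2 = 0 by rewrite scalerBl !scale1r addrAC et subrr.
  by have [_ /eqP] := z12 _ _ e0; rewrite oner_eq0.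
have r23 : ray z2 <> ray (z1 + z2).
  move=> e'; have z20 := indep_neq0 (indepC z12).
  have [t _ et] : exists2 t, 0 <= t & z1 + z2 = t *: z2.
    apply: ray_inv z20 _; rewrite e'; have := @ray_val _ _ (z1 + z2) 1 ler01.
    by rewrite scale1r; exact.
  have e0 : 1 *: z1 + (1 - t) *: z2 = 0 by rewrite scalerBl !scale1r addrA et subrr.
  by have [/eqP + _] := z12 _ _ e0; rewrite oner_eq0.
have r12 : ray z1 <> ray z2.
  move=> e'; have z20 := indep_neq0 (indepC z12).
  have [t _ et] : exists2 t, 0 <= t & z1 = t *: z2.
    apply: ray_inv z20 _; rewrite -e'; have := @ray_val _ _ z1 1 ler01.
    by rewrite scale1r; exact.
  have e0 : 1 *: z1 + (- t) *: z2 = 0 by rewrite scale1r scaleNr et subrr.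
  by have [/eqP + _] := z12 _ _ e0; rewrite oner_eq0.
have d z x y v : S (ray z) = ray y -> S (ray x) = ray v -> ray z <> ray x -> ray y <> ray v.
  by move=> ez ew ne; rewrite -ez -ew => /(congr1 S'); rewrite !K.
have s13 := d _ _ _ _ e1 e3 r13; have s23 := d _ _ _ _ e2 e3 r23; have s12 := d _ _ _ _ e1 e2 r12.
have bp : 0 < b.
  rewrite lt_def b0 andbT; apply/eqP => b00; apply: s23.
  rewrite e b00 scale0r add0r rayZ // lt_def c0 andbT; apply: contra_neq y30 => c00.
  by rewrite e b00 c00 !scale0r addr0.
have cp : 0 < c.
  rewrite lt_def c0 andbT; apply/eqP => c00; apply: s13.
  by rewrite e c00 scale0r addr0 rayZ.
split; last by exists b, c.
apply: contrapT => /(dependent_scale y10)[s es].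
have [sp|sn|s0] := ltrgtP 0 s.
- by apply: s12; rewrite es rayZ.
- have e3' : y3 = (b + c * s) *: y1 by rewrite e es scalerA -scalerDl.
  have [qp|qn|q0] := ltrgtP 0 (b + c * s).
  + by apply: s13; rewrite e3' rayZ.
  + apply: s23; rewrite e3' (_ : (b + c * s) *: y1 = ((b + c * s) / s) *: y2).
      by rewrite rayZ // nmulr_rgt0 // invr_lt0.
    by rewrite es scalerA divfK // lt_eqF.
  + by move: y30; rewrite e3' -q0 scale0r eqxx.
- by move: y20; rewrite es -s0 scale0r eqxx.
Qed.

(* Consider the ray of [z1 + z2]. If it is of the first kind, a linear functional vanishing at [z1] but
   not at [z2] is contradictory; if it is of the second kind, all [g] with [g y1 = 0] and [g <= lin y2] would
   satisfy a common bound [g <= lin y3'], which fails for [hplus (N *: v) N] with [N] large. *)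
Lemma ind_lin_indep a S S' z1 z2 : almost_iso a S S' -> indep z1 z2 ->
  is_ind S z1 -> is_lin S z2 -> False.
Proof.
move=> H z12 [y1 [y10 r1 e1]] l2; have [y2 [y20 r2 e2]] := l2.
have [_ _ _ K K'] := H.
have z10 := indep_neq0 z12; have z20 := indep_neq0 (indepC z12).
pose z3 := z1 + z2.
have z30 : z3 != 0.
  apply/eqP => e0; have e0' : 1 *: z1 + 1 *: z2 = 0 by rewrite !scale1r.
  by have [/eqP + _] := z12 _ _ e0'; rewrite oner_eq0.
have iff f z := almost_iso_ind f H (@seg_indicator R n z).
case: (ind_or_lin H z30).
- move=> /(ind_inv H z30)[y3 [y30 r3 e3 i3]].
  have [y12 [b [c [b0 c0 ey3]]]] := rays_cone H z12 y10 y20 y30 r1 r2 r3.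
  have [x2 [x20 rx2 ex2]] : exists x2, [/\ x2 != 0, ray x2 = ray z2 & S (lin x2) = seg y2].
    have [x2 [x20 f2 g2]] := lin_inv_type H z20 y20 r2 l2.
    by exists x2; rewrite -g2 K' -f2 -r2 K.
  have [t t0 x2z] := ray_eq_scale z20 x20 (esym rx2).
  (* [u] has slope 0 along [z1] and 1 along [x2], so [r] is below [seg z1] and [lin x2], whose
     images are [seg y1] and [seg y2]; yet [r] is positive at [z1 + z2]. *)
  have [u [uz1 uz2]] := indep_dual 0 t^-1 z12.
  pose r := hplus u 0.
  have k1 : (S r y1 <= 0%:E)%E.
    by apply/cle_segP; rewrite -e1; apply: (iff _ _).2.1; apply/hplus_seg; rewrite ?uz1.
  have k2 : (S r y2 <= 0%:E)%E.
    apply/cle_segP; rewrite -ex2.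
    apply: (almost_iso_ind' r H (_ : indicator (S (lin x2)))).2.1.
      by rewrite ex2; exact: seg_indicator.
    by apply/hplus_lin => //; rewrite x2z dotpZr uz2 divff // gt_eqF.
  (* [m *: y3] is the point where the ray of [y3] crosses the segment from [y1] to [y2]. *)
  pose m := (b + c)^-1; have bc : 0 < b + c by rewrite addr_gt0.
  have m0 : 0 < m by rewrite invr_gt0.
  have k3 : (S r (m *: y3) <= 0%:E)%E.
    have T : 0 <= b / (b + c) <= 1.
      by rewrite divr_ge0 ?(ltW b0) ?(ltW bc) //= ler_pdivrMr // mul1r lerDl ltW.
    have := cvx0_conv T k1 k2; rewrite !mulr0 addr0 ey3 scalerDr !scalerA.
    by rewrite (mulrC m) (_ : 1 - b / (b + c) = m * c) //; rewrite /m; field; rewrite gt_eqF.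
  have [x3 [x30 r3' e3']] := ind_scale (almost_iso_sym H) y30 m0 i3.
  have : cle r (seg x3).
    by apply: (iff _ _).2.2; rewrite -e3' K'; apply/cle_segP.
  move/hplus_seg => /(_ (lexx _)).
  have [s s0 ->] : exists2 s, 0 < s & x3 = s *: z3.
    by apply: ray_le_scale => //; rewrite -r3' rayZ // -r3 K; exact: cle_refl.
  by rewrite dotpZr dotpDr uz1 uz2 add0r leNgt mulr_gt0 // invr_gt0.
- move=> l3; have h0 : 0 < (2^-1 : R) by rewrite invr_gt0.
  have [y3 [y30 r3 e3]] := lin_scale H z30 h0 l3.
  rewrite rayZ // in r3.
  have [y12 [b [c [b0 c0 ey3]]]] := rays_cone H z12 y10 y20 y30 r1 r2 r3.
  have [v [v1 v2]] := indep_dual 1 0 y12.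
  (* [g] vanishes on [0, [y1]] and along [y2], but its slope along [y3] is [N * b = 2], more than
     [lin y3] allows. *)
  pose N := 2 / b; have N0 : 0 <= N by rewrite divr_ge0 // ltW.
  pose g := hplus (N *: v) N.
  have g1 : (S' g z1 <= 0%:E)%E.
    apply/cle_segP; apply: (iff _ _).2.2; rewrite K' e1.
    by apply/hplus_seg => //; rewrite dotpZl v1 mulr1.
  have g2 : (S' g z2 <= 0%:E)%E.
    apply/cle_segP; apply: (iff _ _).2.2; rewrite K' e2.
    by apply/hplus_lin => //; rewrite dotpZl v2 mulr0.
  have g3 : (S' g (2^-1 *: z3) <= 0%:E)%E.
    have T : 0 <= (2^-1 : R) <= 1 by lra.
    have := cvx0_conv T g1 g2; rewrite !mulr0 addr0.
    by rewrite (_ : 1 - 2^-1 = 2^-1 :> R) -?scalerDr //; field.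
  have := (iff (S' g) _).2.1 ((cle_segP _ _).2 g3); rewrite K' e3 => /hplus_lin => /(_ N0).
  rewrite ey3 dotpZl dotpDr !dotpZr v1 v2 (_ : N * (b * 1 + c * 0) = 2); first by lra.
  by rewrite /N; field; rewrite gt_eqF.
Qed.

Lemma all_ind_or_all_lin a S S' : (1 < n)%N -> almost_iso a S S' ->
  (forall z, z != 0 -> is_ind S z) \/ (forall z, z != 0 -> is_lin S z).
Proof.
move=> n1 H.
case: (pselect (forall z, z != 0 -> is_ind S z)) => [|nall]; [by left | right].
have [x x0 lx] : exists2 x, x != 0 & is_lin S x.
  apply: contrapT => nex; apply: nall => z z0; case: (ind_or_lin H z0) => // lz.
  by exfalso; apply: nex; exists z.
move=> z z0; case: (ind_or_lin H z0) => // iz; exfalso.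
have [y [xy zy]] := exists_indep2 n1 x0 z0.
have y0 := indep_neq0 (indepC xy).
case: (ind_or_lin H y0) => [iy|ly].
  exact: ind_lin_indep H (indepC xy) iy lx.
exact: ind_lin_indep H zy iz ly.
Qed.

End Types.

(** * Maps preserving triangles with a vertex at the origin *)

Section Hull.
Variables (R : realType) (n : nat).
Implicit Types (x y z u v : 'cV[R]_n) (a b c r s t : R).

(* By duality, [cov x y z] says that [z] lies in the triangle with vertices [0], [x], [y]. *)
Definition cov x y z := forall u, dotp u x <= 1 -> dotp u y <= 1 -> dotp u z <= 1.

Lemma cov_scale x y z u b : cov x y z -> 0 <= b -> dotp u x <= b -> dotp u y <= b -> dotp u z <= b.
Proof.
move=> H b0 ux uy; apply/ler_addgt0Pr => d d0.
have bd : 0 < b + d by rewrite ltr_wpDl.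
have := H ((b + d)^-1 *: u); rewrite !dotpZl ![_ * dotp u _]mulrC !ler_pdivrMr // !mul1r.
by apply; rewrite (le_trans ux, le_trans uy) // lerDl ltW.
Qed.

Lemma cov_comb x y a b : 0 <= a -> 0 <= b -> a + b <= 1 -> cov x y (a *: x + b *: y).
Proof. by move=> a0 b0 ab u ux uy; rewrite dotpDr !dotpZr; nra. Qed.

Lemma covP x y z : indep x y -> cov x y z ->
  exists a b, [/\ 0 <= a, 0 <= b, a + b <= 1 & z = a *: x + b *: y].
Proof.
move=> xy H; have x0 := indep_neq0 xy; have y0 := indep_neq0 (indepC xy).
have [u ux uy|a [b [a0 b0 e]]] := @farkas2 _ _ x y z x0 y0; first exact: cov_scale ux uy.
exists a, b; split=> //; have [u [ux uy]] := indep_dual 1 1 xy.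
by have := H u; rewrite e dotpDr !dotpZr ux uy !mulr1 lexx; exact.
Qed.

Lemma cov_diag x z : x != 0 -> cov x x z -> exists2 t, 0 <= t <= 1 & z = t *: x.
Proof.
move=> x0 H; have [u ux uy|a [b [a0 b0 e]]] := @farkas2 _ _ x x z x0 x0; first exact: cov_scale ux uy.
have xx : dotp x x != 0 by rewrite dotp_eq0.
exists (a + b); last by rewrite scalerDl.
rewrite addr_ge0 //=; have := H ((dotp x x)^-1 *: x).
by rewrite e -scalerDl !dotpZl dotpZr mulrCA mulVf // mulr1 lexx; exact.
Qed.

Definition cov_iso (phi psi : 'cV[R]_n -> 'cV[R]_n) :=
  [/\ cancel phi psi, cancel psi phi, phi 0 = 0 &
   forall x y z, cov x y z <-> cov (phi x) (phi y) (phi z)].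

Lemma cov_iso_sym phi psi : cov_iso phi psi -> cov_iso psi phi.
Proof.
move=> [K K' p0 H]; split=> // [|x y z]; first by rewrite -{1}p0 K.
by rewrite (H (psi x)) !K'.
Qed.

Lemma cov_iso_neq0 phi psi x : cov_iso phi psi -> x != 0 -> phi x != 0.
Proof. by move=> [K _ p0 _] x0; apply: contra_neq x0 => e; rewrite -(K x) e -{1}p0 K. Qed.

Lemma cov_iso_contract phi psi x t : cov_iso phi psi -> x != 0 -> 0 <= t <= 1 ->
  exists2 s, 0 <= s <= 1 & phi (t *: x) = s *: phi x.
Proof.
move=> H x0 /andP[t0 t1]; have [_ _ _ C] := H.
apply: cov_diag; first exact: cov_iso_neq0 H x0.
apply: (C _ _ _).1 => u ux _; rewrite dotpZr.
by have := ler_wpM2l t0 ux; rewrite mulr1 => h; exact: le_trans h t1.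
Qed.

Lemma cov_iso_ray phi psi x t : cov_iso phi psi -> x != 0 -> 0 < t ->
  exists s, [/\ 0 < s, 1 <= t -> 1 <= s & phi (t *: x) = s *: phi x].
Proof.
move=> H x0 t0; have tx0 : t *: x != 0 by rewrite scaler_eq0 (negPf x0) gt_eqF.
have [t1|t1] := ltP t 1.
  have T : 0 <= t <= 1 by rewrite !ltW.
  have [s /andP[s0 _] e] := cov_iso_contract H x0 T.
  exists s; split=> //.
  rewrite lt_def s0 andbT; apply: contra_neq (cov_iso_neq0 H tx0) => s00.
  by rewrite e s00 scale0r.
have T : 0 <= t^-1 <= 1 by rewrite invr_ge0 (ltW t0) invf_le1.
have [s /andP[s0 s1]] := cov_iso_contract H tx0 T.
rewrite scalerA mulVf ?gt_eqF // scale1r => e.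
have sp : 0 < s.
  rewrite lt_def s0 andbT; apply: contra_neq (cov_iso_neq0 H x0) => s00.
  by rewrite e s00 scale0r.
exists s^-1; split=> [|_|]; rewrite ?invr_gt0 ?invf_ge1 //.
by rewrite e scalerA mulVf ?gt_eqF // scale1r.
Qed.

Lemma cov_iso_ray_inv phi psi x z c : cov_iso phi psi -> x != 0 -> 0 <= c ->
  phi z = c *: phi x -> exists s, z = s *: x.
Proof.
move=> H x0 c0 e; have [K _ p0 _] := H.
move: c0; rewrite le_eqVlt => /predU1P[c0|c0].
  by exists 0; rewrite scale0r -(K z) e -c0 scale0r -{1}p0 K.
have [s [_ _ e']] := cov_iso_ray (cov_iso_sym H) (cov_iso_neq0 H x0) c0.
by exists s; rewrite -(K z) e e' K.
Qed.

(** If [phi y] were a negative multiple of [phi x], the image of the midpoint of [x] and [y] would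
    lie on the ray of [phi x] or of [phi y], making the midpoint a multiple of [x] or of [y]. *)
Lemma cov_iso_indep phi psi x y : cov_iso phi psi -> indep x y -> indep (phi x) (phi y).
Proof.
move=> H xy; have x0 := indep_neq0 xy; have y0 := indep_neq0 (indepC xy).
have px0 := cov_iso_neq0 H x0; have py0 := cov_iso_neq0 H y0.
have xNy s : y <> s *: x.
  move=> e; have e0 : (- s) *: x + 1 *: y = 0 by rewrite scaleNr scale1r e addrC subrr.
  by have [_ /eqP] := xy _ _ e0; rewrite oner_eq0.
apply: contrapT => /(dependent_scale px0)[c ec].
have [c0|c0] := leP 0 c.
  by have [s] := cov_iso_ray_inv H x0 c0 ec; exact: xNy.
pose z := 2^-1 *: x + 2^-1 *: y.
have h0 : 0 <= (2^-1 : R) by rewrite invr_ge0.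
have /(let: And4 _ _ _ C := H in C _ _ _) zxy : cov x y z by apply: cov_comb => //; lra.
have [u ux uy|p [q [p0 q0 e]]] := @farkas2 _ _ _ _ (phi z) px0 py0; first exact: cov_scale ux uy.
have e' : phi z = (p + q * c) *: phi x by rewrite e ec scalerA scalerDl.
have [k0|k0] := leP 0 (p + q * c).
  have [s] := cov_iso_ray_inv H x0 k0 e'; rewrite /z => ez.
  apply: (xNy (2 * s - 1)); rewrite scalerBl scale1r -scalerA -ez scalerDr !scalerA.
  by rewrite divff // !scale1r addrC addrA addNr add0r.
have e2 : phi z = ((p + q * c) / c) *: phi y by rewrite e' ec scalerA divfK // lt_eqF.
have k1 : 0 <= (p + q * c) / c by rewrite mulr_le0 ?invr_le0 // ltW.
have [s] := cov_iso_ray_inv H y0 k1 e2; rewrite /z => ez.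
have e0 : 2^-1 *: x + (2^-1 - s) *: y = 0 by rewrite scalerBl addrA ez subrr.
by have [/eqP + _] := xy _ _ e0; rewrite invr_eq0 pnatr_eq0.
Qed.

Lemma indep_coef x y a b c d : indep x y -> a *: x + b *: y = c *: x + d *: y -> a = c /\ b = d.
Proof.
move=> xy e; have e0 : (a - c) *: x + (b - d) *: y = 0.
  by rewrite !scalerBl addrACA e -opprD subrr.
by have [/eqP + /eqP] := xy _ _ e0; rewrite !subr_eq0 => /eqP-> /eqP->.
Qed.

(* If [p < 1], the point [phi (x + y)] lies on the segment from [phi x] to a multiple of [phi y], so
   that [x + y] lies in a triangle over [x] and a multiple of [y], which is absurd. If [p > 1], then
   [p *: phi x = phi (t *: x)] with [t > 1] and the same argument runs in the other direction. *)
Lemma cov_iso_coef phi psi x y p q : cov_iso phi psi -> indep x y -> 0 <= p -> 0 <= q ->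
  phi (x + y) = p *: phi x + q *: phi y -> p = 1.
Proof.
move=> H xy p0 q0 e; have [K K' _ C] := H; have H' := cov_iso_sym H.
have x0 := indep_neq0 xy; have y0 := indep_neq0 (indepC xy).
have px0 := cov_iso_neq0 H x0; have py0 := cov_iso_neq0 H y0.
have pxy := cov_iso_indep H xy.
have qp : 0 < q.
  rewrite lt_def q0 andbT; apply/eqP => q00; move: e; rewrite q00 scale0r addr0 => e.
  have [s es] := cov_iso_ray_inv H x0 p0 e.
  have e0 : (1 - s) *: x + 1 *: y = 0 by rewrite scalerBl !scale1r addrAC es subrr.
  by have [_ /eqP] := xy _ _ e0; rewrite oner_eq0.
apply/eqP; rewrite eq_le !leNgt; apply/andP; split; apply/negP => p1.
- have pp : 0 < p by exact: lt_trans p1.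
  have [t [t0 t1 et]] := cov_iso_ray H' px0 pp; rewrite K in et.
  have {}t1 : 1 < t.
    rewrite lt_def t1 ?ltW // andbT; apply/eqP => t1'.
    move: et; rewrite t1' scale1r => /(congr1 phi); rewrite K' => e1.
    have := @scaler_inj _ _ (phi x) p 1 px0; rewrite scale1r => /(_ e1) p1'.
    by move: p1; rewrite p1' ltxx.
  have d0 : 0 < t - 1 by rewrite subr_gt0.
  (* Chosen with [t^-1 + N^-1 = 1], which puts [x + y] on the segment from [t *: x] to [N *: y]. *)
  pose N := t / (t - 1); have N0 : 0 < N by rewrite divr_gt0.
  have [N' [N'0 _ eN]] := cov_iso_ray H y0 N0.
  have /C : cov (t *: x) (N *: y) (x + y).
    rewrite (_ : x + y = t^-1 *: (t *: x) + N^-1 *: (N *: y)); last first.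
      by rewrite !scalerA !mulVf ?gt_eqF // !scale1r.
    apply: cov_comb; rewrite ?invr_ge0 ?(ltW t0) ?(ltW N0) //.
    by rewrite le_eqVlt; apply/orP; left; apply/eqP; rewrite /N; field; rewrite !gt_eqF.
  rewrite -et K' eN e => /covP[|m [k [m0 k0 mk]]].
    by apply: indepZ => //; rewrite gt_eqF.
  rewrite !scalerA => /(indep_coef pxy)[e1 e2].
  have m1 : m = 1 by apply: (@mulIf _ p); rewrite ?gt_eqF // mul1r.
  have k00 : k = 0 by apply/eqP; rewrite eq_le k0 andbT; move: mk; rewrite m1; lra.
  by move: qp; rewrite e2 k00 mul0r ltxx.
- have d0 : 0 < 1 - p by rewrite subr_gt0.
  pose c := q / (1 - p); have c0 : 0 < c by rewrite divr_gt0.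
  have [t [t0 _ et]] := cov_iso_ray H' py0 c0; rewrite K in et.
  have : cov (phi x) (phi (t *: y)) (phi (x + y)).
    rewrite -et K' e (_ : q *: phi y = (1 - p) *: (c *: phi y)); last first.
      by rewrite scalerA /c mulrC divfK // gt_eqF.
    by apply: cov_comb => //; [exact: ltW | rewrite addrC subrK].
  move=> /(C _ _ _).2/covP[|m [k [m0 k0 mk]]].
    by rewrite -[x]scale1r; apply: indepZ => //; rewrite ?oner_eq0 // gt_eqF.
  rewrite scalerA -{1}[x]scale1r -{1}[y]scale1r => /(indep_coef xy)[e1 e2].
  have k00 : k = 0 by apply/eqP; rewrite eq_le k0 andbT; move: mk; rewrite -e1; lra.
  by move: e2; rewrite k00 mul0r => /eqP; rewrite oner_eq0.
Qed.

(** The midpoint shows that [phi (x + y)] is a nonnegative combination of [phi x] and [phi y];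
    [cov_iso_coef], applied in both orders, makes the coefficients 1. *)
Lemma cov_iso_add_indep phi psi x y : cov_iso phi psi -> indep x y -> phi (x + y) = phi x + phi y.
Proof.
move=> H xy; have h0 : 0 <= (2^-1 : R) by rewrite invr_ge0.
have pxy := cov_iso_indep H xy.
pose z := 2^-1 *: x + 2^-1 *: y.
have xyz : x + y = 2 *: z by rewrite scalerDr !scalerA divff // !scale1r.
have z0 : z != 0.
  apply/eqP => z0; have [/eqP + _] := xy _ _ z0.
  by rewrite invr_eq0 pnatr_eq0.
have /(let: And4 _ _ _ C := H in C _ _ _) : cov x y z by apply: cov_comb => //; lra.
move=> /(covP pxy)[p [q [p0 q0 _ e]]].
have [s [s0 _ es]] := cov_iso_ray H z0 (ltr0Sn _ 1).
have e' : phi (x + y) = (s * p) *: phi x + (s * q) *: phi y.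
  by rewrite xyz es e scalerDr !scalerA.
have sp : 0 <= s * p by rewrite mulr_ge0 // ltW.
have sq : 0 <= s * q by rewrite mulr_ge0 // ltW.
have p1 := cov_iso_coef H xy sp sq e'.
have q1 : s * q = 1.
  by apply: (cov_iso_coef H (indepC xy) sq sp); rewrite addrC e' addrC.
by rewrite e' p1 q1 !scale1r.
Qed.

Lemma cov_isoN phi psi x : (1 < n)%N -> cov_iso phi psi -> phi (- x) = - phi x.
Proof.
move=> n1 H; have [->|x0] := eqVneq x 0.
  by case: H => _ _ p0 _; rewrite oppr0 p0 oppr0.
have [y xy] := exists_indep n1 x0.
have I : indep (x + y) (- x).
  have := @indep_comb _ _ x y 1 1 (-1) 0; rewrite !scale1r scaleN1r scale0r addr0; apply => //.
apply/eqP; rewrite -addr_eq0; apply/eqP.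
have := cov_iso_add_indep H I; rewrite addrAC subrr add0r (cov_iso_add_indep H xy) => e.
by apply: (@addrI _ (phi y)); rewrite addr0 {2}e addrAC addrC [phi x + _]addrC addrA.
Qed.

Lemma cov_isoD phi psi x y : (1 < n)%N -> cov_iso phi psi -> phi (x + y) = phi x + phi y.
Proof.
move=> n1 H; have p0 : phi 0 = 0 by case: H.
have [->|x0] := eqVneq x 0; first by rewrite p0 !add0r.
case: (pselect (indep x y)) => [|/(dependent_scale x0)[s ->]]; first exact: cov_iso_add_indep H.
have [->|s0] := eqVneq s 0; first by rewrite scale0r p0 !addr0.
have [->|s1] := eqVneq s (-1).
  by rewrite scaleN1r subrr p0 (cov_isoN _ n1 H) subrr.
(* The sum is regrouped as [(x + w) + (s *: x - w)], an independent pair because [s] is not -1. *)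
have [w xw] := exists_indep n1 x0.
have I : indep (x + w) (s *: x - w).
  have := @indep_comb _ _ x w 1 1 s (-1); rewrite !scale1r scaleN1r; apply => //.
  by rewrite !mul1r -opprD oppr_eq0 addrC addr_eq0.
have I' : indep (s *: x) (- w).
  by rewrite -scaleN1r; apply: indepZ => //; rewrite oppr_eq0 oner_eq0.
have -> : x + s *: x = (x + w) + (s *: x - w) by rewrite addrACA subrr addr0.
rewrite (cov_iso_add_indep H I) (cov_iso_add_indep H xw) (cov_iso_add_indep H I').
by rewrite (cov_isoN _ n1 H) addrACA subrr addr0.
Qed.

Lemma cov_iso_natmul phi psi x m : (1 < n)%N -> cov_iso phi psi -> phi (x *+ m) = phi x *+ m.
Proof.
move=> n1 H; elim: m => [|m IH]; first by rewrite !mulr0n; case: H.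
by rewrite !mulrS (cov_isoD _ _ n1 H) IH.
Qed.

(** Additivity settles integer factors. For real [s], the product [M * s] is an integer plus a
    remainder in [0, 1], and [phi] keeps the remainder in [0, 1]; so the error is at most [1 / M]
    for every positive integer [M]. *)
Lemma cov_isoZ phi psi x t : (1 < n)%N -> cov_iso phi psi -> phi (t *: x) = t *: phi x.
Proof.
move=> n1 H; have p0 : phi 0 = 0 by case: H.
suff pos s : 0 < s -> phi (s *: x) = s *: phi x.
  have [t0|t0|->] := ltrgtP t 0; [|exact: pos|by rewrite !scale0r].
  rewrite -[t *: x]opprK -scaleNr (cov_isoN _ n1 H) pos ?oppr_gt0 //.
  by rewrite scaleNr opprK.
have [->|x0] := eqVneq x 0; first by rewrite scaler0 p0 scaler0.
move=> s0; have [r [r0 _ er]] := cov_iso_ray H x0 s0; rewrite er; congr (_ *: _).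
have bound N : `|r - s| * N.+1%:R <= 1.
  pose M : R := N.+1%:R; have M0 : 0 <= M by exact: ler0n.
  have Ns0 : 0 <= M * s by rewrite mulr_ge0 // ltW.
  pose m := Num.truncn (M * s).
  have /andP[m1 m2] := truncn_itv Ns0; rewrite -/m -addn1 natrD in m1 m2.
  have T : 0 <= M * s - m%:R <= 1 by rewrite subr_ge0 m1 lerBlDr addrC ltW.
  have [q /andP[q0 q1] eq] := cov_iso_contract H x0 T.
  have : (M * r) *: phi x = (m%:R + q) *: phi x.
    have natZ k y : phi (k%:R *: y) = k%:R *: phi y.
      by rewrite !scaler_nat (cov_iso_natmul _ _ n1 H).
    have e : M *: (s *: x) = m%:R *: x + (M * s - m%:R) *: x.
      by rewrite -scalerDl scalerA; congr (_ *: _); rewrite addrC subrK.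
    have := congr1 phi e; rewrite /M natZ -/M (cov_isoD _ _ n1 H) natZ eq er scalerA.
    by rewrite -scalerDl.
  move/(scaler_inj (cov_iso_neq0 H x0)) => Mr.
  rewrite -/M -(ger0_norm M0) -normrM mulrBl mulrC Mr (mulrC s).
  by rewrite ler_norml; case/andP: T => T0 T1; apply/andP; split; lra.
apply/eqP; rewrite -subr_eq0 -normr_eq0 eq_le normr_ge0 andbT leNgt; apply/negP => d0.
have := bound (Num.truncn `|r - s|^-1).
rewrite leNgt mulrC -ltr_pdivrMr //.
by rewrite mul1r truncnS_gt.
Qed.

Lemma additive_scalable_matrix (phi : 'cV[R]_n -> 'cV[R]_n) :
  (forall x y, phi (x + y) = phi x + phi y) -> (forall t x, phi (t *: x) = t *: phi x) ->
  exists B : 'M[R]_n, forall x, phi x = B *m x.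
Proof.
move=> D Z; exists (\matrix_(i, j) phi (delta_mx j 0) i 0) => x.
have phi0 : phi 0 = 0 by have := Z 0 0; rewrite !scale0r.
rewrite {1}(matrix_sum_delta x) (big_morph phi D phi0).
apply/matrixP => i j; rewrite (ord1 j) summxE mxE; apply: eq_bigr => k _.
by rewrite big_ord1 Z !mxE mulrC.
Qed.

Lemma cov_iso_linear phi psi : (1 < n)%N -> cov_iso phi psi ->
  exists2 B : 'M[R]_n, B \in unitmx & forall x, phi x = B *m x.
Proof.
move=> n1 H; have H' := cov_iso_sym H.
have [B eB] := additive_scalable_matrix (fun x y => cov_isoD x y n1 H) (fun t x => cov_isoZ x t n1 H).
have [C eC] := additive_scalable_matrix (fun x y => cov_isoD x y n1 H') (fun t x => cov_isoZ x t n1 H').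
exists B => //; have BC : B *m C = 1%:M.
  apply/matrixP => i j; have [_ K' _ _] := H.
  have := congr1 (fun v : 'cV[R]_n => v i 0) (K' (delta_mx j 0)).
  rewrite eC eB mulmxA -colE !mxE eqxx andbT => ->.
  by [].
by case/mulmx1_unit: BC.
Qed.

End Hull.

(** * The geometric transform *)

Section GeometricTransform.
Variables (R : realType) (n : nat).
Implicit Types (x y z u : 'cV[R]_n) (a b c r s t v : R) (f g h : cvx0 R n).

(** A point [y] with a real bound [s > 0], [f y <= s], contributes [(dotp x y - 1) / s], which is
    the pair [u = s^-1 *: y], [b = s^-1]. At zeros of [f], small [s] produces the polar
    condition. *)
Definition gtr f : cvx0 R n := supaff (fun u b => 0 < b /\ (f (b^-1 *: u) <= (b^-1)%:E)%E).

Lemma gtr_le f x v : 0 < v ->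
  (gtr f x <= v%:E)%E <-> forall y, (((dotp x y - 1) / v)%:E <= f y)%E.
Proof.
move=> v0; split=> [/supaff_le[_ H] y|H].
  case/ge0_ereal_real: (cvx0_ge0 f y) => [->|[r r0 e]]; first exact: leey.
  rewrite e lee_fin; apply/ler_addgt0Pr => d d0.
  have rd : 0 < r + d by rewrite ltr_wpDl.
  have rdi : 0 < (r + d)^-1 by rewrite invr_gt0.
  have := H ((r + d)^-1 *: y) (r + d)^-1 (ltW rdi).
  rewrite invrK scalerA divff ?gt_eqF // scale1r e lee_fin lerDl (ltW d0).
  move=> /(_ (conj rdi isT)); rewrite dotpZl (dotpC y) -[X in _ - X]mulr1 -mulrBr.
  by rewrite ler_pdivrMl // ler_pdivrMr.
apply/supaff_le; split=> [|u b b0 [bp fu]]; first exact: ltW.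
have := le_trans (H (b^-1 *: u)) fu; rewrite lee_fin dotpZr (dotpC x).
rewrite ler_pdivrMr // ler_pdivlMl // mulrBr mulr1 mulrA divff ?gt_eqF // mul1r.
by [].
Qed.

(* A negative value would bound the convex function [f >= 0] by an affine function on a line. *)
Lemma geometric_transform_ge0 f x : (0 <= geometric_transform f x)%E.
Proof.
rewrite /geometric_transform; case: asboolP => // px.
rewrite /Defs.ereal_sup0; case: ifPn => [/asboolP ne|_]; last by rewrite lexx.
have [y fy] : exists y, (0 < f y)%E by case: ne => e [y fy _]; exists y.
rewrite leNgt; apply/negP => sup0.
have [e e0 He] : exists2 e : R, 0 < e &
    forall z, (0 < f z)%E -> ((dotp x z - 1)%:E / f z <= (- e)%:E)%E.
  have [e e0 le] : exists2 e : R, 0 < e & (ereal_sup [set ((dotp x y - 1)%:E / f y)%E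
      | y in [set y | (0 < f y)%E]] <= (- e)%:E)%E.
    move: sup0; case: (ereal_sup _) => [s| |] //; last by exists 1; rewrite ?leNye.
    by rewrite lte_fin => s0; exists (- s); rewrite ?opprK ?oppr_gt0.
  by exists e => // z fz; apply: le_trans le; apply: ereal_sup_ubound; exists z => //.
have bd z : exists2 r, 0 <= r & f z = r%:E /\ r * e <= 1 - dotp x z.
  case/ge0_ereal_real: (cvx0_ge0 f z) => [ez|[r r0 ez]].
    by have := He z; rewrite ez invey mule0 lee_fin oppr_ge0 leNgt e0 => /(_ (ltry _)).
  exists r => //; split=> //.
  have [r00|rn0] := eqVneq r 0.
    by rewrite r00 mul0r subr_ge0; apply: px; rewrite /= ez r00.
  have rp : 0 < r by rewrite lt_def rn0.
  have := He z; rewrite ez inver gt_eqF // lte_fin -EFinM lee_fin => /(_ rp).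
  by rewrite ler_pdivrMr // mulNr; lra.
have [r r0 [er _]] := bd y; have rp : 0 < r by rewrite er lte_fin in fy.
have line t : 0 <= 1 - t * dotp x y.
  by have [s s0 [_]] := bd (t *: y); rewrite dotpZr; apply: le_trans; rewrite mulr_ge0 // ltW.
have xy0 : 0 <= dotp x y.
  rewrite leNgt; apply/negP => xy; have := line (2 / dotp x y).
  by rewrite divfK ?lt_eqF //; lra.
(* Convexity gives [f (t *: y) >= t * r], while [bd] gives [f (t *: y) * e <= 1]; this [t] makes
   [t * (r * e) = r * e + 2]. *)
pose t := 1 + 2 / (r * e); have re : 0 < r * e by rewrite mulr_gt0.
have t1 : 1 <= t by rewrite lerDl divr_ge0 // ltW.
have tp : 0 < t by exact: lt_le_trans t1.
have [s s0 [es]] := bd (t *: y); rewrite dotpZr => bs.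
have T : 0 <= t^-1 <= 1 by rewrite invr_ge0 (ltW tp) invf_le1.
have := @cvx0_scale _ _ f (t *: y) s t^-1 T; rewrite es lexx => /(_ isT).
rewrite scalerA mulVf ?gt_eqF // scale1r er lee_fin ler_pdivlMl // => ts.
have : t * (r * e) = r * e + 2 by rewrite /t mulrDl mul1r divfK // gt_eqF.
have : t * r * e <= s * e by rewrite ler_pM2r.
have : 0 <= t * dotp x y by rewrite mulr_ge0 // ltW.
rewrite -mulrA; lra.
Qed.

Lemma geometric_transform_le f x v : 0 < v ->
  (geometric_transform f x <= v%:E)%E <-> forall y, (((dotp x y - 1) / v)%:E <= f y)%E.
Proof.
move=> v0; have val y r : 0 < r -> ((((dotp x y - 1)%:E / r%:E)%E <= v%:E)%E =
    ((dotp x y - 1) / v <= r)).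
  by move=> r0; rewrite inver gt_eqF // -EFinM lee_fin !ler_pdivrMr // mulrC.
have at0 y : f y = 0%E -> ((((dotp x y - 1) / v)%:E <= f y)%E = (dotp x y <= 1)).
  by move=> ->; rewrite lee_fin pmulr_lle0 ?invr_gt0 // subr_le0.
rewrite /geometric_transform; case: asboolP => [px|npx]; split.
- rewrite /Defs.ereal_sup0 => H y.
  case/ge0_ereal_real: (cvx0_ge0 f y) => [->|[r r0 e]]; first exact: leey.
  have [r00|rn0] := eqVneq r 0; first by rewrite at0 ?e ?r00 //; apply: px; rewrite /= e r00.
  have rp : 0 < r by rewrite lt_def rn0.
  rewrite e lee_fin -val // -e; apply: le_trans H.
  case: asboolP => [_|]; last by case; exists ((dotp x y - 1)%:E / f y)%E, y => //=; rewrite e lte_fin.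
  by apply: ereal_sup_ubound; exists y => //=; rewrite e lte_fin.
- move=> H; rewrite /Defs.ereal_sup0; case: asboolP => _; last by rewrite lee_fin ltW.
  apply: ge_ereal_sup => _ [y /= fy <-].
  case/ge0_ereal_real: (cvx0_ge0 f y) => [->|[r r0 e]]; first by rewrite invey mule0 lee_fin ltW.
  by rewrite e val; [have := H y; rewrite e lee_fin | rewrite e lte_fin in fy].
- by [].
- move=> H; exfalso; apply: npx => y /= fy; by rewrite -at0.
Qed.

Lemma gtrE f x : gtr f x = geometric_transform f x.
Proof.
apply/eqP; rewrite eq_le; apply/andP.
split; apply: lee_real; rewrite ?cvx0_ge0 ?geometric_transform_ge0 // => r r0 H.
  by apply/gtr_le => //; apply/geometric_transform_le.
by apply/geometric_transform_le => //; apply/gtr_le.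
Qed.

Lemma gtr_cle f g : cle f g -> cle (gtr g) (gtr f).
Proof.
move=> fg; apply: cleP => x r r0; rewrite !gtr_le // => H y.
exact: le_trans (H y) (fg y).
Qed.

(** The relation [dotp x y - 1 <= v * w] is symmetric in the epigraph points [(x, v)] and [(y, w)],
    which gives one inequality. For the other, a minorant [(u, b)] of [f] yields an epigraph point
    of [gtr f] once [b] is enlarged by [d] to be positive. *)
Lemma gtrK : involutive gtr.
Proof.
move=> f; apply: cle_anti; apply: cleP => y w w0.
  move=> fy; apply/gtr_le => // x.
  case/ge0_ereal_real: (cvx0_ge0 (gtr f) x) => [->|[r r0 e]]; first exact: leey.
  rewrite e lee_fin; apply/ler_addgt0Pr => d d0.
  have rd : 0 < r + d by rewrite ltr_wpDl.
  have : (gtr f x <= (r + d)%:E)%E by rewrite e lee_fin lerDl ltW.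
  move=> /(gtr_le _ _ rd)/(_ y)/le_trans/(_ fy); rewrite lee_fin dotpC !ler_pdivrMr //.
  by rewrite mulrC.
rewrite gtr_le // => H; apply/cvx0_leP; split=> [|u b [b0 ub]]; first exact: ltW.
apply/ler_addgt0Pr => d d0; have bd : 0 < b + d by rewrite ltr_wpDl.
have fu : (gtr f ((b + d)^-1 *: u) <= ((b + d)^-1)%:E)%E.
  apply/gtr_le; first by rewrite invr_gt0.
  move=> x; apply: le_trans (ub x); rewrite lee_fin dotpZl invrK mulrBl mul1r mulrAC.
  by rewrite mulVf ?gt_eqF // mul1r lerD2l lerN2 lerDl ltW.
have := le_trans (H ((b + d)^-1 *: u)) fu; rewrite lee_fin ler_pdivrMr // dotpZr (dotpC y).
rewrite ler_pdivlMl // mulrBr mulr1 mulrA divff ?gt_eqF // mul1r; lra.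
Qed.

Lemma gtr_csc a f : 0 < a -> csc a (gtr (csc a f)) = gtr f.
Proof.
move=> a0; apply: cle_anti; apply: cleP => x r r0.
  rewrite gtr_le // => H; apply/csc_le => //; apply/gtr_le; first by rewrite divr_gt0.
  move=> y; rewrite invfM invrK mulrA.
  case/ge0_ereal_real: (cvx0_ge0 (csc a f) y) => [->|[s s0 e]]; first exact: leey.
  have : (csc a f y <= s%:E)%E by rewrite e.
  move=> /(csc_le _ _ _ a0)/(le_trans (H y)); rewrite e !lee_fin.
  by rewrite ler_pdivlMr // mulrC.
move=> /(csc_le _ _ _ a0); rewrite !gtr_le ?divr_gt0 // => H y.
case/ge0_ereal_real: (cvx0_ge0 f y) => [->|[s s0 e]]; first exact: leey.
have : (csc a f y <= (a * s)%:E)%E by apply/cscK; rewrite // e.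
move=> /(le_trans (H y)); rewrite e !lee_fin invfM invrK mulrA => H'.
by rewrite -(ler_pM2l a0) mulrC.
Qed.

Lemma legendre_le f x v :
  (legendre f x <= v%:E)%E <-> forall y, ((dotp x y - v)%:E <= f y)%E.
Proof.
have val y : (((dotp x y)%:E - f y <= v%:E) = ((dotp x y - v)%:E <= f y))%E.
  case/ge0_ereal_real: (cvx0_ge0 f y) => [->|[r r0 ->]]; first by rewrite addeNy leNye leey.
  by rewrite -EFinB !lee_fin lerBlDr lerBlDl.
split=> [H y|H].
  by rewrite -val; apply: le_trans H; apply: ereal_sup_ubound; exists y.
by apply: ge_ereal_sup => _ [y _ <-]; rewrite val.
Qed.

(** Both sides say that [dotp x y - v <= f y] for all [y]. *)
Lemma legendre_gtr f x v : 0 < v ->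
  (legendre f x <= v%:E)%E <-> (gtr f (v^-1 *: x) <= (v^-1)%:E)%E.
Proof.
move=> v0; rewrite legendre_le gtr_le ?invr_gt0 //.
suff e y : (dotp (v^-1 *: x) y - 1) / v^-1 = dotp x y - v.
  by split=> H y; have := H y; rewrite e.
by rewrite invrK dotpZl; field; rewrite gt_eqF.
Qed.

Lemma legendre_ge0 f x : (0 <= legendre f x)%E.
Proof. by apply: ereal_sup_ubound; exists 0 => //; rewrite dotp0r cvx0_at0 sube0. Qed.

Lemma almost_iso_gtr a T T' : 1 < a -> cancel T T' -> cancel T' T ->
  almost_order_reversing a T -> almost_order_reversing a T' ->
  almost_iso a (T \o gtr) (gtr \o T').
Proof.
move=> a1 K K' HT HT'; have a0 : 0 < a by exact: lt_trans a1.
have ai : 0 < a^-1 by rewrite invr_gt0.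
have R1 U f g : almost_order_reversing a U -> cle f g -> cle (U g) (csc a (U f)).
  move=> HU fg; apply: cleP => x r r0 /(csc_le _ _ _ a0) fx.
  have := le_trans ((HU f g).1 fg x) fx.
  by rewrite lee_mul_real // invrK divfK // gt_eqF.
have R2 U f g : almost_order_reversing a U -> cle (csc a f) g -> cle (U g) (U f).
  move=> HU fg; apply: (HU f g).2 => x.
  case/ge0_ereal_real: (cvx0_ge0 g x) => [->|[s s0 e]]; first by rewrite gt0_muley ?lte_fin ?leey.
  have : (csc a f x <= s%:E)%E by apply: le_trans (fg x) _; rewrite e.
  by move/(csc_le _ _ _ a0); rewrite e -EFinM mulrC.
split=> //.
- split=> f g /= fg; first by apply: R1 HT _; exact: gtr_cle.
  apply: R2 HT _; rewrite -(gtr_csc f a0); apply: csc_cle => //; exact: gtr_cle.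
- split=> f g /= fg; last by apply: gtr_cle; exact: R2 HT' fg.
  have := R1 _ _ _ HT' fg => le1.
  have : cle (csc a^-1 (T' g)) (T' f).
    by have := csc_cle ai le1; rewrite csc_csc // mulVf ?gt_eqF // csc1.
  move/gtr_cle/cle_trans; apply.
  rewrite -[X in cle _ (csc a (gtr X))]csc1 -(@divff _ a) ?gt_eqF // -csc_csc //.
  by rewrite gtr_csc //; exact: cle_refl.
- by move=> f /=; rewrite K gtrK.
- by move=> f /=; rewrite gtrK K'.
Qed.

End GeometricTransform.

(** * Linearity of the induced maps on points *)

Section LinearPart.
Variables (R : realType) (n : nat).
Implicit Types (x y z u v : 'cV[R]_n) (a b c r s t : R) (f g h : cvx0 R n).
Implicit Types (S : cvx0 R n -> cvx0 R n) (phi psi : 'cV[R]_n -> 'cV[R]_n).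

Lemma seg_inj : injective (@seg R n).
Proof.
move=> y z e; have [y0|y0] := eqVneq y 0.
  apply/eqP; rewrite y0 eq_sym; apply: contraT => z0.
  by case: (seg_neq_delta z0); rewrite -e y0 seg0.
have [z0|z0] := eqVneq z 0.
  by case: (seg_neq_delta y0); rewrite e z0 seg0.
have yz : (seg y z <= 0%:E)%E by apply/cle_segP; rewrite e; exact: cle_refl.
have zy : (seg z y <= 0%:E)%E by apply/cle_segP; rewrite e; exact: cle_refl.
have [t /andP[t0 t1] ez] := seg_inv y0 yz; have [s /andP[s0 s1] ey] := seg_inv z0 zy.
have st : 1 = s * t by apply: (scaler_inj y0); rewrite scale1r -scalerA -ez.
have t11 : t = 1.
  apply/eqP; rewrite eq_le t1 /= st; apply: le_trans (_ : 1 * t <= _); last by rewrite mul1r.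
  by rewrite ler_wpM2r.
by rewrite ez t11 scale1r.
Qed.

Lemma lin_inj : injective (@lin R n).
Proof.
move=> y z e; have [y0|y0] := eqVneq y 0.
  apply/eqP; rewrite y0 eq_sym; apply: contraT => z0.
  by case: (lin_neq_delta z0); rewrite -e y0 lin0.
have [z0|z0] := eqVneq z 0.
  by case: (lin_neq_delta y0); rewrite e z0 lin0.
have val x : (lin x x <= 1%:E)%E by have := lin_val x ler01; rewrite scale1r.
have yz : (lin y z <= 1%:E)%E by rewrite e.
have zy : (lin z y <= 1%:E)%E by rewrite -e.
have [t [t0 t1 ez]] := lin_inv y0 yz; have [s [s0 s1 ey]] := lin_inv z0 zy.
have st : 1 = s * t by apply: (scaler_inj y0); rewrite scale1r -scalerA -ez.
have t11 : t = 1.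
  apply/eqP; rewrite eq_le t1 /= st; apply: le_trans (_ : 1 * t <= _); last by rewrite mul1r.
  by rewrite ler_wpM2r.
by rewrite ez t11 scale1r.
Qed.

(** Rewrites the triangle relation with order comparisons against indicators only, which [S]
    respects exactly; [cov_lin] does the same for functions whose images are indicators. *)
Lemma cov_seg x y z :
  cov x y z <-> forall f, cle f (seg x) -> cle f (seg y) -> cle f (seg z).
Proof.
split=> [H f /cle_segP/cvx0_leP[_ fx] /cle_segP/cvx0_leP[_ fy]|H u ux uy].
  apply/cle_segP/cvx0_leP; split=> // u b ub; rewrite subr_le0.
  by apply: (cov_scale H ub.1); rewrite -subr_le0; [exact: fx | exact: fy].
by apply/(hplus_seg u z ler01); apply: H; apply/hplus_seg.
Qed.

Lemma cle_lin_minorant f z : cle f (lin z) <-> forall u b, minorant f u b -> dotp u z <= 1.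
Proof.
split=> [H u b /minorantP[b0 uf]|H]; last by apply: cle_supaff => u b /H.
by apply/(hplus_lin u z b0); exact: cle_trans uf H.
Qed.

Lemma cov_lin x y z :
  cov x y z <-> forall f, cle f (lin x) -> cle f (lin y) -> cle f (lin z).
Proof.
split=> [H f /cle_lin_minorant fx /cle_lin_minorant fy|H u ux uy].
  by apply/cle_lin_minorant => u b /[dup] /fx ux /fy uy; exact: H.
by apply/(hplus_lin u z (lexx 0)); apply: H; apply/hplus_lin.
Qed.

Lemma almost_iso_all_ind a S S' : almost_iso a S S' ->
  (forall z, z != 0 -> is_ind S z) -> forall y, y != 0 -> is_ind S' y.
Proof.
move=> H A y y0; case: (ind_or_lin (almost_iso_sym H) y0) => // ly; exfalso.
have [x [x0 e _]] := ly; have := lin_inv_type (almost_iso_sym H) y0 x0 e ly.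
exact: ind_not_lin (A _ x0).
Qed.

Lemma almost_iso_all_lin a S S' : almost_iso a S S' ->
  (forall z, z != 0 -> is_lin S z) -> forall y, y != 0 -> is_lin S' y.
Proof.
move=> H A y y0; case: (ind_or_lin (almost_iso_sym H) y0) => // /(ind_inv (almost_iso_sym H) y0).
by move=> [x [x0 _ _ ix]]; case: (ind_not_lin ix (A _ x0)).
Qed.

Lemma all_ind_linear a S S' : (1 < n)%N -> almost_iso a S S' ->
  (forall z, z != 0 -> is_ind S z) ->
  exists2 B : 'M[R]_n, B \in unitmx & forall z, S (seg z) = seg (B *m z).
Proof.
move=> n1 H A; have [_ _ _ K K'] := H.
have map U U' : almost_iso a U U' -> (forall z, z != 0 -> is_ind U z) ->
    forall z, exists y, U (seg z) = seg y.
  move=> HU AU z; have [->|/AU[y [_ _ e]]] := eqVneq z 0; last by exists y.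
  by exists 0; rewrite seg0 (almost_iso_delta HU).
have [phi ephi] := choice (map _ _ H A).
have [psi epsi] := choice (map _ _ (almost_iso_sym H) (almost_iso_all_ind H A)).
have iso : cov_iso phi psi.
  split=> [z|z||x y z].
  - by apply: seg_inj; rewrite -epsi -ephi K.
  - by apply: seg_inj; rewrite -ephi -epsi K'.
  - by apply: seg_inj; rewrite -ephi seg0 (almost_iso_delta H).
  have I f w : cle f (seg w) <-> cle (S f) (seg (phi w)).
    by rewrite -ephi; exact: (almost_iso_ind f H (@seg_indicator _ _ w)).2.
  rewrite !cov_seg; split=> C f fx fy; last first.
    by apply: (I _ _).2; apply: C; exact: (I _ _).1.
  rewrite -(K' f) in fx fy *.
  by apply: (I _ _).1; apply: C; exact: (I _ _).2.
have [B Bu eB] := cov_iso_linear n1 iso.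
by exists B => // z; rewrite ephi eB.
Qed.

(* On its ray, [lin z] is comparable with every [S' (seg y)], because the latter is linear; hence
   [S (lin z)] is comparable with every [seg y], which forces it to be the indicator of a segment. *)
Lemma all_lin_lin_to_seg a S S' z : almost_iso a S S' -> (forall z, z != 0 -> is_lin S z) ->
  z != 0 -> exists y, S (lin z) = seg y.
Proof.
move=> H A z0; have H' := almost_iso_sym H; have [_ _ _ K K'] := H.
have [z' z'0 Sz] := almost_iso_ray H z0; set G := S (lin z).
have zG : cle (ray z') G.
  by rewrite -Sz; apply: (almost_iso_ind _ H (@ray_indicator _ _ _)).1.1; exact: ray_lin.
have cmp t : 0 < t -> cle (seg (t *: z')) G \/ (G (t *: z') <= 0%:E)%E.
  move=> t0; have y0 : t *: z' != 0 by rewrite scaler_eq0 (negPf z'0) gt_eqF.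
  have [x [x0 rx sx]] := almost_iso_all_lin H A y0.
  have [s s0 xz] : exists2 s, 0 < s & x = s *: z.
    by apply: ray_eq_scale => //; rewrite -rx rayZ // -Sz K.
  have [I1 I2] := almost_iso_ind G H' (@seg_indicator _ _ (t *: z')).
  rewrite sx /G K in I1 I2.
  have [s1|s1] := leP s 1; [right | left].
    apply/cle_segP; apply/I2.2; apply/cle_linP => r r0; rewrite xz scalerA.
    have rs : 0 <= r * s by rewrite mulr_ge0 // ltW.
    by apply: le_trans (lin_val z rs) _; rewrite lee_fin ler_piMr.
  apply/I1.2; rewrite xz; apply/cle_linP => r r0.
  have -> : r *: z = (r / s) *: (s *: z) by rewrite scalerA divfK // gt_eqF.
  have rs : 0 <= r / s by rewrite divr_ge0 // ltW.
  by apply: le_trans (lin_val _ rs) _; rewrite lee_fin ler_pdivrMr // ler_peMr // ltW.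
have IG : indicator G.
  move=> x r gx; have [s s0 ex] := ray_inv z'0 (le_trans (zG x) gx).
  move: s0; rewrite le_eqVlt => /predU1P[s0|s0].
    by rewrite ex -s0 scale0r cvx0_at0.
  rewrite ex in gx *; rewrite -(mulr0 s); apply: ray_limit => // t t0 ts; rewrite mulr0.
  move: t0; rewrite le_eqVlt => /predU1P[<-|t0]; first by rewrite scale0r cvx0_at0.
  case: (cmp _ t0) => // /(_ (s *: z')) le1.
  have y0 : t *: z' != 0 by rewrite scaler_eq0 (negPf z'0) gt_eqF.
  have [q /andP[_ q1]] := seg_inv y0 (le_trans le1 gx).
  rewrite scalerA => /(scaler_inj z'0) e; exfalso.
  by move: ts; rewrite e ltNge ler_piMl // ltW.
have [||t _ e] := indicator_seg z'0 zG _ _ IG; last by exists (t *: z').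
  exact: almost_iso_neq_delta H (lin_neq_delta z0).
rewrite -Sz => /(congr1 S'); rewrite !K => e.
have : (ray z z <= 0%:E)%E by have := @ray_val _ _ z 1 ler01; rewrite scale1r.
rewrite -e => /(lin_inv z0)[t [t0 t0']]; rewrite -{1}[z]scale1r => /(scaler_inj z0) t1.
by move: t0'; rewrite -t1 ler10.
Qed.

Lemma all_lin_linear1 a S S' : (1 < n)%N -> almost_iso a S S' ->
  (forall z, z != 0 -> is_lin S z) ->
  exists2 B : 'M[R]_n, B \in unitmx & forall z, S (lin z) = seg (B *m z).
Proof.
move=> n1 H A; have [_ _ _ K K'] := H.
have ex1 z : exists y, S (lin z) = seg y.
  have [->|z0] := eqVneq z 0; last exact: all_lin_lin_to_seg H A z0.
  by exists 0; rewrite lin0 seg0 (almost_iso_delta H).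
have ex2 z : exists y, S' (seg z) = lin y.
  have [->|z0] := eqVneq z 0.
    by exists 0; rewrite lin0 seg0 (almost_iso_delta (almost_iso_sym H)).
  by have [y [_ _ e]] := almost_iso_all_lin H A z0; exists y.
have [phi ephi] := choice ex1; have [psi epsi] := choice ex2.
have iso : cov_iso phi psi.
  split=> [z|z||x y z].
  - by apply: lin_inj; rewrite -epsi -ephi K.
  - by apply: seg_inj; rewrite -ephi -epsi K'.
  - by apply: seg_inj; rewrite -ephi lin0 seg0 (almost_iso_delta H).
  have I f w : cle f (lin w) <-> cle (S f) (seg (phi w)).
    by rewrite -ephi; apply: (almost_iso_ind' f H _).2; rewrite ephi; exact: seg_indicator.
  rewrite cov_lin cov_seg; split=> C f fx fy; last first.
    by apply: (I _ _).2; apply: C; exact: (I _ _).1.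
  rewrite -(K' f) in fx fy *.
  by apply: (I _ _).1; apply: C; exact: (I _ _).2.
have [B Bu eB] := cov_iso_linear n1 iso.
by exists B => // z; rewrite ephi eB.
Qed.

(** Independent [y] and [z] have equal eigenvalues because [y + z] is an eigenvector as well; a
    vector independent of both links any two. *)
Lemma eigen_scalar (M : 'M[R]_n) : (1 < n)%N ->
  (forall z, z != 0 -> exists2 t, 0 < t & M *m z = t *: z) ->
  exists2 t, 0 < t & forall z, M *m z = t *: z.
Proof.
move=> n1 H; pose x : 'cV[R]_n := delta_mx (Ordinal (ltnW n1)) 0.
have x0 : x != 0.
  apply/eqP => /matrixP/(_ (Ordinal (ltnW n1)) 0); rewrite !mxE !eqxx => /eqP.
  by rewrite oner_eq0.
have same y z s t : indep y z -> M *m y = s *: y -> M *m z = t *: z -> s = t.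
  move=> yz ey ez; have yz0 : y + z != 0.
    apply/eqP => e0; have e1 : 1 *: y + 1 *: z = 0 by rewrite !scale1r.
    by have [/eqP + _] := yz _ _ e1; rewrite oner_eq0.
  have [r _] := H _ yz0; rewrite mulmxDr ey ez scalerDr => /(indep_coef yz)[-> ->].
  by [].
have [t t0 ex] := H _ x0; exists t => // z.
have [->|z0] := eqVneq z 0; first by rewrite mulmx0 scaler0.
have [y [xy zy]] := exists_indep2 n1 x0 z0.
have [s s0 ez] := H _ z0; have [r r0 ey] := H _ (indep_neq0 (indepC xy)).
by rewrite ez (same _ _ _ _ zy ez ey) -(same _ _ _ _ xy ex ey).
Qed.

(** The actions on [lin] and on [seg] give two linear maps, [B] and [invmx C], which send [z] into
    the same ray. Hence every nonzero vector is an eigenvector of [C *m B], which is a positive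
    scalar [t]. *)
Lemma all_lin_linear a S S' : (1 < n)%N -> almost_iso a S S' ->
  (forall z, z != 0 -> is_lin S z) ->
  exists (t : R) (B : 'M[R]_n), [/\ 0 < t, B \in unitmx &
    forall z, S (lin z) = seg (B *m z) /\ S (seg z) = lin (t^-1 *: (B *m z))].
Proof.
move=> n1 H A; have H' := almost_iso_sym H; have [_ _ _ K K'] := H.
have [B Bu eB] := all_lin_linear1 n1 H A.
have [C Cu eC] := all_lin_linear1 n1 H' (almost_iso_all_lin H A).
have eC' z : S (seg z) = lin (invmx C *m z).
  by rewrite -{1}(mulKVmx Cu z) -eC K'.
have [|t t0 et] := @eigen_scalar (C *m B) n1.
  move=> z z0; have [y y0 Sz] := almost_iso_ray H z0.
  have Bz : B *m z != 0 by apply: contra_neq z0 => e; rewrite -(mulKmx Bu z) e mulmx0.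
  have Cz : invmx C *m z != 0.
    by apply: contra_neq z0 => e; rewrite -(mulKVmx Cu z) e mulmx0.
  have yB : cle (ray y) (seg (B *m z)).
    by rewrite -Sz -eB; apply: (almost_iso_ind _ H (@ray_indicator _ _ _)).1.1; exact: ray_lin.
  have yC : cle (ray y) (lin (invmx C *m z)).
    by rewrite -Sz -eC'; apply: (almost_iso_ind _ H (@ray_indicator _ _ _)).1.1; exact: ray_seg.
  have [p p0 ep] := ray_inv y0 ((cle_segP _ _).1 yB).
  have yC1 := (cle_linP _ _).1 yC _ ler01; rewrite scale1r in yC1.
  have [q q0 eq] := ray_inv y0 yC1.
  have pp : 0 < p by rewrite lt_def p0 andbT; apply: contra_neq Bz => e; rewrite ep e scale0r.
  have qp : 0 < q by rewrite lt_def q0 andbT; apply: contra_neq Cz => e; rewrite eq e scale0r.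
  exists (p / q); first by rewrite divr_gt0.
  rewrite -mulmxA ep (_ : p *: y = (p / q) *: (q *: y)); last by rewrite scalerA divfK // gt_eqF.
  by rewrite -eq -scalemxAr mulKVmx.
exists t, B; split=> // z; split; first exact: eB.
by rewrite eC' -{1}(scale1r z) -(@mulVf _ t) ?gt_eqF // -scalerA -et -mulmxA -scalemxAr mulKmx.
Qed.

End LinearPart.

(** * Two-sided bounds *)

Section LinearType.
Variables (R : realType) (n : nat) (a l : R) (S S' : cvx0 R n -> cvx0 R n) (B : 'M[R]_n).
Hypotheses (H : almost_iso a S S') (l0 : 0 < l) (Bu : B \in unitmx).
Hypothesis SE : forall z, S (lin z) = seg (B *m z) /\ S (seg z) = lin (l^-1 *: (B *m z)).
Implicit Types (x z : 'cV[R]_n) (c v : R) (f g : cvx0 R n).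

Let a0 : 0 < a. Proof. by case: H => a1 _ _ _ _; exact: lt_trans a1. Qed.

Let B_neq0 z : z != 0 -> B *m z != 0.
Proof. by apply: contra_neq => e; rewrite -(mulKmx Bu z) e mulmx0. Qed.

Let lin_ind f z : (cle (lin z) f <-> cle (seg (B *m z)) (S f)).
Proof.
rewrite -(SE z).1; apply: (almost_iso_ind' f H _).1.
by rewrite (SE z).1; exact: seg_indicator.
Qed.

Let seg_ind f z : (cle (seg z) f <-> cle (lin (l^-1 *: (B *m z))) (S f)).
Proof. by rewrite -(SE z).2; apply: (almost_iso_ind f H (@seg_indicator _ _ z)).1. Qed.

(** The parts [seg z] and [lin (c^-1 *: z)] of [tri z c] become [lin (l^-1 *: (B *m z))] and
    [seg (c^-1 *: (B *m z))], whose maximum is the triangle function on the left. Only the converse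
    bound loses a factor [a]. *)
Lemma linear_type_tri_ge z c : z != 0 -> 0 < c ->
  cle (tri (c^-1 *: (B *m z)) (l / c)) (S (tri z c)).
Proof.
move=> z0 c0; apply: tri_cle_max; first by rewrite scaler_eq0 invr_eq0 gt_eqF ?B_neq0.
- exact: divr_gt0.
- by rewrite scalemxAr; apply/lin_ind; exact: lin_tri.
- rewrite scalerA (_ : (l / c)^-1 * c^-1 = l^-1); last by field; rewrite !gt_eqF.
  by apply/seg_ind; apply: seg_tri; exact: ltW.
Qed.

Lemma linear_type_tri_le z c : z != 0 -> 0 < c ->
  cle (S (tri z c)) (csc a (tri (c^-1 *: (B *m z)) (l / c))).
Proof.
move=> z0 c0; have [_ [S1 _] _ _ K'] := H.
rewrite -[tri (_ *: _) _]K'; apply: S1; have lc : 0 < l / c by exact: divr_gt0.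
apply: tri_cle_max => //.
  apply/seg_ind; rewrite K'.
  rewrite (_ : l^-1 *: (B *m z) = (l / c)^-1 *: (c^-1 *: (B *m z))); first exact: lin_tri.
  by rewrite scalerA; congr (_ *: _); field; rewrite !gt_eqF.
by apply/lin_ind; rewrite K' scalemxAr; apply: seg_tri; exact: ltW.
Qed.

(** [legendre g x <= v] means [gtr g <= tri (v^-1 *: x) v^-1], a triangle function whose image is
    [tri (B *m x) (l * v)] up to [a]. The second [a] comes from applying [S] to the inequality. *)
Lemma linear_type_le g x v : 0 < v -> (legendre g x <= v%:E)%E ->
  (S (gtr g) (B *m x) <= (a ^+ 2 * l * v)%:E)%E.
Proof.
move=> v0; have [_ [S1 _] _ _ _] := H; have [->|x0] := eqVneq x 0.
  by move=> _; rewrite mulmx0 cvx0_at0 lee_fin !mulr_ge0 ?exprn_ge0 // ltW.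
have vi : 0 < v^-1 by rewrite invr_gt0.
have vx : v^-1 *: x != 0 by rewrite scaler_eq0 (negPf x0) gt_eqF.
move=> /(legendre_gtr _ _ v0)/(cle_triP _ _ (ltW vi)).2/S1/(_ (B *m x)) le1.
apply: le_trans le1 _; rewrite expr2 -!mulrA; apply/cscK => //.
apply: le_trans (linear_type_tri_le vx vi _) _; apply/cscK => //.
rewrite !invrK -scalemxAr scalerA divff ?gt_eqF // scale1r.
by apply/cle_triP; [rewrite mulr_ge0 // ltW | exact: cle_refl].
Qed.

Lemma linear_type_ge g x v : 0 < v -> (S (gtr g) (B *m x) <= v%:E)%E ->
  (legendre g x <= (a / l * v)%:E)%E.
Proof.
move=> v0 le1; have [_ _ [_ T2] K _] := H.
have w0 : 0 < a / l * v by rewrite mulr_gt0 // divr_gt0.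
have [->|x0] := eqVneq x 0.
  apply/legendre_le => y; apply: le_trans (cvx0_ge0 _ _).
  by rewrite dotp0l sub0r lee_fin oppr_le0 ltW.
set w := a / l * v in w0 *; have wi : 0 < w^-1 by rewrite invr_gt0.
have wx : w^-1 *: x != 0 by rewrite scaler_eq0 (negPf x0) gt_eqF.
apply/legendre_gtr => //; apply/(cle_triP _ _ (ltW wi)).
rewrite -[gtr g]K -[tri _ _]K; apply: T2.
apply: cle_trans (linear_type_tri_ge wx wi).
rewrite !invrK -scalemxAr scalerA divff ?gt_eqF // scale1r.
apply/cle_triP; first by rewrite mulr_ge0 // ltW.
rewrite (_ : l * w = a * v); last by rewrite /w; field; rewrite gt_eqF.
exact/cscK.
Qed.

End LinearType.

(** * Heights of triangle functions when segments go to segments *)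

Section IndicatorType.
Variables (R : realType) (n : nat) (a : R) (S S' : cvx0 R n -> cvx0 R n) (B : 'M[R]_n).
Hypotheses (n1 : (1 < n)%N) (H : almost_iso a S S') (Bu : B \in unitmx).
Hypothesis SE : forall z, S (seg z) = seg (B *m z).
Implicit Types (x y z w : 'cV[R]_n) (c v r s t : R) (f g : cvx0 R n).

Let a1 : 1 < a. Proof. by case: H. Qed.
Let a0 : 0 < a. Proof. exact: lt_trans a1. Qed.
Let a1' : 1 <= a. Proof. exact: ltW. Qed.

Let B_neq0 z : z != 0 -> B *m z != 0.
Proof. by apply: contra_neq => e; rewrite -(mulKmx Bu z) e mulmx0. Qed.

Let B_indep x y : indep x y -> indep (B *m x) (B *m y).
Proof.
move=> xy p q; rewrite !scalemxAr -mulmxDr => e; apply: xy.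
by rewrite -(mulKmx Bu (_ + _)) e mulmx0.
Qed.

Let ind_ge f z : cle (seg z) f <-> cle (seg (B *m z)) (S f).
Proof. by rewrite -SE; exact: (almost_iso_ind f H (@seg_indicator _ _ z)).1. Qed.

Let ind_le f z : cle f (seg z) <-> cle (S f) (seg (B *m z)).
Proof. by rewrite -SE; exact: (almost_iso_ind f H (@seg_indicator _ _ z)).2. Qed.

Lemma indicator_type_ray z : z != 0 -> S (ray z) = ray (B *m z).
Proof.
move=> z0; have [y y0 Sz] := almost_iso_ray H z0; rewrite Sz.
have : cle (ray y) (seg (B *m z)).
  by rewrite -Sz -SE; apply: (almost_iso_ind _ H (@ray_indicator _ _ _)).1.1; exact: ray_seg.
move=> /cle_segP/(ray_inv y0)[t t0 e]; rewrite e rayZ // lt_def t0 andbT.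
by apply: contra_neq (B_neq0 z0) => t00; rewrite e t00 scale0r.
Qed.

Let onray f z : z != 0 -> cle (ray z) f -> cle (ray (B *m z)) (S f).
Proof.
by move=> z0 zf; rewrite -indicator_type_ray //; apply: (almost_iso_ind _ H (@ray_indicator _ _ _)).1.1.
Qed.

(** The value +oo would put [seg (s *: w)] below [lin w], and the value 0 would put [lin w] below
    [seg (s *: w)]; neither is possible. *)
Lemma indicator_type_lin w s : w != 0 -> 0 < s ->
  exists2 r, 0 < r & S (lin w) (s *: (B *m w)) = r%:E.
Proof.
move=> w0 s0; have sw : s *: w != 0 by rewrite scaler_eq0 (negPf w0) gt_eqF.
case: (ge0_ereal_real (cvx0_ge0 (S (lin w)) (s *: (B *m w)))) => [e|[r r0 e]].
  exfalso; apply: (seg_not_cle_lin sw w0); apply/ind_ge; rewrite -scalemxAr.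
  apply: seg_cle_ge; first by rewrite scaler_eq0 (negPf (B_neq0 w0)) gt_eqF.
    by rewrite rayZ //; apply: onray => //; exact: ray_lin.
  move=> t r t1; rewrite scalerA => le1.
  have T : 0 <= s <= t * s by rewrite (ltW s0) ler_peMl // ltW.
  by have := cvx0_ray_mono T le1; rewrite e.
exists r => //; rewrite lt_def r0 andbT; apply/eqP => r00.
apply: (lin_not_cle_seg w0 sw); apply/ind_le; rewrite -scalemxAr.
by apply/cle_segP; rewrite e r00.
Qed.

(** [S' F] dominates both parts of [tri z c], and on [0, [B *m z]] the [seg] part of [F] vanishes.
    One [a] is built into [F], the other is due to [S]. *)
Lemma indicator_type_tri_lin z c s r : z != 0 -> 0 < c -> 0 <= s <= 1 ->
  (S (lin (c^-1 *: z)) (s *: (B *m z)) <= r%:E)%E ->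
  (S (tri z c) (s *: (B *m z)) <= (a ^+ 2 * r)%:E)%E.
Proof.
move=> z0 c0 s01 le1; have [_ [S1 _] [_ T2] K K'] := H.
pose F := cmax (seg (B *m z)) (csc a (S (lin (c^-1 *: z)))).
have : cle (tri z c) (S' F).
  apply: tri_cle_max => //; first by apply/ind_ge; rewrite K'; exact: cmax_l.
  by rewrite -[lin _]K; apply: T2; exact: cmax_r.
move=> /S1; rewrite K' => /(_ (s *: (B *m z))) le2; apply: le_trans le2 _.
rewrite expr2 -mulrA; apply/cscK => //; apply/cmax_le; split; last exact/cscK.
apply: le_trans (seg_val _ s01) _.
by rewrite lee_fin mulr_ge0 ?(ltW a0) // (cvx0_real le1).
Qed.

Lemma indicator_type_lin_tri z c r s : 0 < c ->
  (S (tri z c) (s *: (B *m z)) <= r%:E)%E ->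
  (S (lin (c^-1 *: z)) (s *: (B *m z)) <= (a * r)%:E)%E.
Proof.
move=> c0 le1; have [_ [S1 _] _ _ _] := H.
by apply: le_trans (S1 _ _ (lin_tri z c0) _) _; apply/cscK.
Qed.

(** The height of the image triangle at its vertex. For [z != 0] and [0 < c] the value is finite by
    [tipP], so [fine] loses nothing. *)
Definition tip z c := fine (S (tri z c) (B *m z)).

Lemma tipP z c : z != 0 -> 0 < c -> 0 < tip z c /\ S (tri z c) (B *m z) = (tip z c)%:E.
Proof.
move=> z0 c0; have cz : c^-1 *: z != 0 by rewrite scaler_eq0 (negPf z0) invr_eq0 gt_eqF.
have [r r0] := indicator_type_lin cz c0.
rewrite -scalemxAr scalerA divff ?gt_eqF // => e.
have le1 : (S (lin (c^-1 *: z)) (1 *: (B *m z)) <= r%:E)%E by rewrite e.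
have := indicator_type_tri_lin z0 c0 (_ : 0 <= 1 <= 1) le1.
rewrite ler01 lexx scale1r => /(_ isT) le2.
case/ge0_ereal_real: (cvx0_ge0 (S (tri z c)) (B *m z)) => [e'|[p p0 e']].
  by rewrite e' in le2.
rewrite /tip e' /=; split=> //; rewrite lt_def p0 andbT; apply/eqP => p00.
have : cle (tri z c) (seg z) by apply/ind_le; apply/cle_segP; rewrite e' p00.
move/cle_segP/(tri_inv z0 (ltW c0)) => [t [_ tc]]; rewrite -{1}[z]scale1r => /(scaler_inj z0) t1.
by move: tc; rewrite -t1 mul1r leNgt c0.
Qed.

Lemma tip_gt0 z c : z != 0 -> 0 < c -> 0 < tip z c.
Proof. by move=> z0 c0; case: (tipP z0 c0). Qed.

Lemma tip_le z c : z != 0 -> 0 < c -> (S (tri z c) (B *m z) <= (tip z c)%:E)%E.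
Proof. by move=> z0 c0; case: (tipP z0 c0) => _ ->. Qed.

Lemma tip_le_real z c r : z != 0 -> 0 < c -> (S (tri z c) (B *m z) <= r%:E)%E -> tip z c <= r.
Proof. by move=> z0 c0; case: (tipP z0 c0) => _ ->; rewrite lee_fin. Qed.

(* [z] lies on the segment from [x] to a point [y] off the line of [x]. An affine minorant of
   [S (tri x c) / a] can be tilted so as to vanish at [B y]; its preimage under [S] is then at most
   [c] at [x] and [0] at [y], hence at most [t * c] at [z]. *)
Lemma tip_indep x z c t : indep x z -> 0 < c -> 0 < t < 1 ->
  t * tip x c <= a ^+ 2 * tip z (t * c).
Proof.
move=> xz c0 /andP[t0 t1]; have [_ [S1 _] [_ T2] K K'] := H.
have x0 := indep_neq0 xz; have z0 := indep_neq0 (indepC xz).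
have tc : 0 < t * c by rewrite mulr_gt0.
have t1' : 0 < 1 - t by rewrite subr_gt0.
have [y [xy ez]] : exists y, indep x y /\ z = t *: x + (1 - t) *: y.
  exists ((1 - t)^-1 *: (z - t *: x)); split; last first.
    by rewrite scalerA divff ?gt_eqF // scale1r addrC subrK.
  have -> : (1 - t)^-1 *: (z - t *: x) = (- ((1 - t)^-1 * t)) *: x + (1 - t)^-1 *: z.
    by rewrite scalerBr scalerA scaleNr addrC.
  rewrite -[x in indep x]addr0 -(scale0r z) -[x in indep (x + _)]scale1r.
  apply: indep_comb => //.
  by rewrite mul1r mul0r subr0 invr_eq0 gt_eqF.
pose Q := csc a^-1 (S (tri x c)).
have ai : 0 < a^-1 by rewrite invr_gt0.
suff : (Q (B *m x) <= (a * tip z (t * c) / t)%:E)%E.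
  move=> /(csc_le _ _ _ ai); rewrite invrK => /(tip_le_real x0 c0) le1.
  rewrite -ler_pdivlMl //; apply: le_trans le1 _.
  by rewrite le_eqVlt; apply/orP; left; apply/eqP; field; rewrite gt_eqF.
apply/cvx0_leP; split.
  by rewrite divr_ge0 ?mulr_ge0 ?(ltW t0) ?(ltW a0) // ltW // tip_gt0.
(* [Q] is finite only on the ray of [B *m x], so a minorant may be altered off that ray: [u'] agrees
   with [u] at [B *m x] and equals [b] at [B *m y]. *)
move=> u b [b0 ub]; have [u' [ux uy]] := indep_dual (dotp u (B *m x)) b (B_indep xy).
have GQ : cle (hplus u' b) Q.
  apply: hplus_cle => // p r Qp.
  have [q q0 ep] : exists2 q, 0 <= q & p = q *: (B *m x).
    apply: (@ray_inv _ _ _ _ (r / a^-1)); first exact: B_neq0.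
    move: Qp => /(csc_le _ _ _ ai); apply: le_trans; apply: onray => //.
    by apply: ray_tri; exact: ltW.
  have := le_trans (ub p) Qp; rewrite lee_fin ep !dotpZr ux.
  by [].
have G1 : cle (S' (hplus u' b)) (tri x c).
  rewrite -[tri x c]K; apply: T2; have := csc_cle a0 GQ.
  by rewrite /Q csc_csc // divff ?gt_eqF // csc1.
have G2 : cle (S' (hplus u' b)) (seg y).
  by apply/ind_le; rewrite K'; apply/hplus_seg; rewrite ?uy.
have T : 0 <= t <= 1 by rewrite !ltW.
have Gz := cvx0_conv T ((cle_triP _ _ (ltW c0)).1 G1) ((cle_segP _ _).1 G2).
rewrite -ez mulr0 addr0 in Gz.
have := S1 _ _ ((cle_triP _ _ (ltW tc)).2 Gz) (B *m z); rewrite K' => le1.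
have : (hplus u' b (B *m z) <= (a * tip z (t * c))%:E)%E.
  by apply: le_trans le1 _; apply/cscK => //; exact: tip_le.
move=> /(hplus_le _ _ _ b0)[_].
rewrite {1}ez mulmxDr -!scalemxAr dotpDr !dotpZr ux uy ler_pdivlMr // => le2.
by apply: le_trans le2; lra.
Qed.

(** [x] and [z] may be dependent, so the comparison passes through some [y] independent of both,
    splitting the ratio as [p * (t / p)] with [p] strictly between [t] and 1. *)
Lemma tip_any x z c t : x != 0 -> z != 0 -> 0 < c -> 0 < t < 1 ->
  t * tip x c <= a ^+ 4 * tip z (t * c).
Proof.
move=> x0 z0 c0 /andP[t0 t1]; have [y [xy zy]] := exists_indep2 n1 x0 z0.
have y0 := indep_neq0 (indepC xy).
pose p := (1 + t) / 2; have p0 : 0 < p by rewrite /p; lra.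
have p1 : p < 1 by rewrite /p; lra.
have q0 : 0 < t / p by rewrite divr_gt0.
have q1 : t / p < 1 by rewrite ltr_pdivrMr // mul1r /p; lra.
have pc : 0 < p * c by rewrite mulr_gt0.
have le1 := @tip_indep x y c p xy c0 (introT andP (conj p0 p1)).
have le2 := @tip_indep y z (p * c) (t / p) (indepC zy) pc (introT andP (conj q0 q1)).
rewrite mulrA divfK ?gt_eqF // in le2.
have -> : t * tip x c = (t / p) * (p * tip x c) by rewrite mulrA divfK // gt_eqF.
apply: le_trans (ler_wpM2l (ltW q0) le1) _; rewrite mulrCA.
have -> : a ^+ 4 * tip z (t * c) = a ^+ 2 * (a ^+ 2 * tip z (t * c)) by ring.
by rewrite ler_pM2l // exprn_gt0.
Qed.

Lemma tip_mono z c c' : z != 0 -> 0 < c -> c <= c' -> tip z c <= a * tip z c'.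
Proof.
move=> z0 c0 cc'; have [_ [S1 _] _ _ _] := H; have c'0 := lt_le_trans c0 cc'.
have : cle (tri z c) (tri z c').
  apply/(cle_triP _ _ (ltW c'0)); apply: le_trans (_ : (_ <= c%:E)%E) _; last by rewrite lee_fin.
  by apply/(cle_triP _ _ (ltW c0)); exact: cle_refl.
move=> /S1/(_ (B *m z)) le1; apply: tip_le_real => //.
by apply: le_trans le1 _; apply/cscK => //; exact: tip_le.
Qed.

(** Using the ratio [s / 2] in [tip_any] and then [tip_mono] admits [s = 1], at the price of a
    factor 2 and one more [a]. *)
Lemma tip_lower x z c s : x != 0 -> z != 0 -> 0 < c -> 0 < s <= 1 ->
  s * tip x c <= 2 * a ^+ 5 * tip z (s * c).
Proof.
move=> x0 z0 c0 /andP[s0 s1]; have sc : 0 < s * c by rewrite mulr_gt0.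
have h0 : 0 < s / 2 by rewrite divr_gt0.
have h1 : s / 2 < 1 by lra.
have le1 := tip_any x0 z0 c0 (introT andP (conj h0 h1)).
have hc : 0 < s / 2 * c by rewrite mulr_gt0.
have hc' : s / 2 * c <= s * c by rewrite ler_pM2r //; lra.
have := ler_wpM2l (exprn_ge0 4 (ltW a0)) (tip_mono z0 hc hc').
have -> : a ^+ 4 * (a * tip z (s * c)) = a ^+ 5 * tip z (s * c) by ring.
move: le1; set X := tip x c; set Y := tip z _; set Z := tip z _; lra.
Qed.

(** [tri x c] and [tri (s *: x) (s * c)] are pieces of the same linear function, and convexity of
    its image along the ray gives the factor [s]. Passing to [lin] costs one [a], passing back costs
    two. *)
Lemma tip_scale x c s : x != 0 -> 0 < c -> 0 < s <= 1 ->
  tip (s *: x) (s * c) <= a ^+ 3 * s * tip x c.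
Proof.
move=> x0 c0 /andP[s0 s1]; have sc : 0 < s * c by rewrite mulr_gt0.
have sx : s *: x != 0 by rewrite scaler_eq0 (negPf x0) gt_eqF.
have le1 : (S (tri x c) (1 *: (B *m x)) <= (tip x c)%:E)%E by rewrite scale1r; exact: tip_le.
have T : 0 <= s <= 1 by rewrite ltW.
have := cvx0_scale T (indicator_type_lin_tri c0 le1); rewrite scale1r => le2.
have le3 : (S (lin ((s * c)^-1 *: (s *: x))) (1 *: (B *m (s *: x))) <= (s * (a * tip x c))%:E)%E.
  by rewrite scale1r -scalemxAr scalerA invfM mulrAC mulVf ?gt_eqF // mul1r.
have := indicator_type_tri_lin sx sc (_ : 0 <= 1 <= 1) le3.
rewrite ler01 lexx scale1r => /(_ isT)/(tip_le_real sx sc).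
by rewrite (_ : a ^+ 2 * (s * (a * tip x c)) = a ^+ 3 * s * tip x c) //; ring.
Qed.

Lemma tip_upper x z c s : x != 0 -> z != 0 -> 0 < c -> 0 < s <= 1 ->
  tip z (s * c) <= 2 * a ^+ 8 * s * tip x c.
Proof.
move=> x0 z0 c0 s01; case/andP: (s01) => s0 s1.
have sx : s *: x != 0 by rewrite scaler_eq0 (negPf x0) gt_eqF.
have sc : 0 < s * c by rewrite mulr_gt0.
have one : 0 < (1 : R) <= 1 by rewrite ltr01 lexx.
have le1 := tip_lower z0 sx sc one; rewrite !mul1r in le1.
apply: le_trans le1 _.
rewrite (_ : 2 * a ^+ 8 * s * tip x c = 2 * a ^+ 5 * (a ^+ 3 * s * tip x c)); last by ring.
by rewrite ler_pM2l ?mulr_gt0 ?exprn_gt0 //; exact: tip_scale.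
Qed.

Lemma tip_equiv x z c : x != 0 -> z != 0 -> 0 < c ->
  c * tip x 1 <= 2 * a ^+ 8 * tip z c /\ tip z c <= 2 * a ^+ 8 * c * tip x 1.
Proof.
move=> x0 z0 c0.
have K58 : 2 * a ^+ 5 <= 2 * a ^+ 8 by rewrite ler_pM2l // ler_weXn2l.
have [c1|c1] := leP c 1.
  have c01 : 0 < c <= 1 by rewrite c0.
  have := tip_lower x0 z0 ltr01 c01; have := tip_upper x0 z0 ltr01 c01; rewrite mulr1.
  move=> le2 le1; split=> //; apply: le_trans le1 _.
  by rewrite ler_pM2r // tip_gt0.
(* For [c > 1] the roles of [x] and [z] are exchanged, with ratio [c^-1]. *)
have ci : 0 < c^-1 by rewrite invr_gt0.
have ci1 : 0 < c^-1 <= 1 by rewrite ci invf_le1 // ltW.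
have := tip_lower z0 x0 c0 ci1; have := tip_upper z0 x0 c0 ci1; rewrite mulVf ?gt_eqF //.
move=> le2 le1; split.
  by rewrite mulrC -ler_pdivlMr // mulrAC.
rewrite -mulrA mulrCA -ler_pdivrMl //; apply: le_trans le1 _.
by rewrite ler_pM2r // tip_gt0.
Qed.

Lemma indicator_type_le x f z v : x != 0 -> 0 < v -> (f z <= v%:E)%E ->
  (S f (B *m z) <= (2 * a ^+ 9 * tip x 1 * v)%:E)%E.
Proof.
move=> x0 v0 fz; have [_ [S1 _] _ _ _] := H.
have p0 := tip_gt0 x0 ltr01.
have [->|z0] := eqVneq z 0.
  by rewrite mulmx0 cvx0_at0 lee_fin !mulr_ge0 ?exprn_ge0 // ltW.
apply: le_trans (S1 _ _ ((cle_triP _ _ (ltW v0)).2 fz) _) _.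
have -> : 2 * a ^+ 9 * tip x 1 * v = a * (2 * a ^+ 8 * v * tip x 1) by ring.
apply/cscK => //; apply: le_trans (tip_le z0 v0) _; rewrite lee_fin.
by case: (tip_equiv x0 z0 v0).
Qed.

(** At [s *: (B *m z)] the comparison is with [tri (s *: z) (s * c)], whose image has its vertex
    there and which shares its [lin] with [tri z c]. This costs [a ^+ 3] on top of the [a ^+ 8] of
    [tip_equiv]. *)
Lemma indicator_type_tri_ge x z c : x != 0 -> z != 0 -> 0 < c ->
  cle (tri (B *m z) (tip x 1 * c / (2 * a ^+ 11))) (S (tri z c)).
Proof.
move=> x0 z0 c0; have p0 := tip_gt0 x0 ltr01.
have D : 0 < 2 * a ^+ 11 by rewrite mulr_gt0 ?exprn_gt0.
apply: tri_cle_ge; first exact: B_neq0.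
- by rewrite divr_ge0 ?mulr_ge0 // ltW.
- by apply: (ind_ge _ _).1; apply: seg_tri; exact: ltW.
move=> s r /andP[s0 s1] le1.
move: s0; rewrite le_eqVlt => /predU1P[<-|s0]; first by rewrite mul0r (cvx0_real le1).
have sz : s *: z != 0 by rewrite scaler_eq0 (negPf z0) gt_eqF.
have sc : 0 < s * c by rewrite mulr_gt0.
have le2 := indicator_type_lin_tri c0 le1.
have le3 : (S (lin ((s * c)^-1 *: (s *: z))) (1 *: (B *m (s *: z))) <= (a * r)%:E)%E.
  by rewrite scale1r -scalemxAr scalerA invfM mulrAC mulVf ?gt_eqF // mul1r.
have := indicator_type_tri_lin sz sc (_ : 0 <= 1 <= 1) le3.
rewrite ler01 lexx scale1r => /(_ isT)/(tip_le_real sz sc) le4.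
have [le5 _] := tip_equiv x0 sz sc.
rewrite mulrA ler_pdivrMr //; apply: le_trans (_ : s * c * tip x 1 <= _).
  by rewrite le_eqVlt; apply/orP; left; apply/eqP; ring.
apply: le_trans le5 _; rewrite (_ : r * _ = 2 * a ^+ 8 * (a ^+ 2 * (a * r))); last by ring.
by rewrite ler_pM2l // mulr_gt0 ?exprn_gt0.
Qed.

Lemma indicator_type_ge x f z v : x != 0 -> 0 < v -> (S f (B *m z) <= v%:E)%E ->
  (f z <= (2 * a ^+ 12 / tip x 1 * v)%:E)%E.
Proof.
move=> x0 v0 le1; have [_ _ [_ T2] K _] := H.
have p0 := tip_gt0 x0 ltr01.
have c0 : 0 < 2 * a ^+ 12 / tip x 1 * v by rewrite !mulr_gt0 ?invr_gt0 ?exprn_gt0.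
have [->|z0] := eqVneq z 0; first by rewrite cvx0_at0 lee_fin ltW.
apply/(cle_triP _ _ (ltW c0)); rewrite -[f]K -[tri _ _]K; apply: T2.
apply: cle_trans (indicator_type_tri_ge x0 z0 c0).
have -> : tip x 1 * (2 * a ^+ 12 / tip x 1 * v) / (2 * a ^+ 11) = a * v.
  by field; rewrite !gt_eqF ?exprn_gt0.
by apply/cle_triP; [rewrite mulr_ge0 // ltW | apply/cscK].
Qed.

End IndicatorType.

(** Turns bounds along [B *m x] for real [v] into extended-valued bounds at [x], which is why the
    matrix of the conclusion is [invmx B]. *)
Lemma two_sided_bound (R : realType) (n : nat) (D l : R) (B : 'M[R]_n)
    (h : cvx0 R n) (e : 'cV[R]_n -> \bar R) (x : 'cV[R]_n) :
  0 < D -> 0 < l -> B \in unitmx -> (forall x, (0 <= e x)%E) ->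
  (forall x v, 0 < v -> (e x <= v%:E)%E -> (h (B *m x) <= (D * l * v)%:E)%E) ->
  (forall x v, 0 < v -> (h (B *m x) <= v%:E)%E -> (e x <= (D / l * v)%:E)%E) ->
  ((D^-1 * l)%:E * e (invmx B *m x)%R <= h x)%E /\
  (h x <= (D * l)%:E * e (invmx B *m x)%R)%E.
Proof.
move=> D0 l0 Bu e0 up low; have Dl : 0 < D * l by rewrite mulr_gt0.
have Dil : 0 < D^-1 * l by rewrite mulr_gt0 // invr_gt0.
have xE : x = B *m (invmx B *m x) by rewrite mulKVmx.
split; apply: lee_real => [||r r0 le1]; rewrite ?cvx0_ge0 ?mule_ge0 ?lee_fin ?(ltW Dl) ?(ltW Dil) //.
  rewrite lee_mul_real // [r / _](_ : _ = D / l * r); last by field; rewrite !gt_eqF.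
  by apply: low => //; rewrite -xE.
rewrite lee_mul_real // in le1; have rv : 0 < r / (D * l) by rewrite divr_gt0.
by rewrite xE; apply: le_trans (up _ _ rv le1) _; rewrite mulrC divfK // gt_eqF.
Qed.

Theorem theorem1p8 (R : realType) (Ct : R) (hCt : 1 < Ct) :
  exists c C : R, [/\ 0 < c, 0 < C &
    forall (n : nat) (T Tinv : cvx0 R n -> cvx0 R n),
      (2 <= n)%N ->
      cancel T Tinv -> cancel Tinv T ->
      almost_order_reversing Ct T -> almost_order_reversing Ct Tinv ->
      (exists (lam : R) (B : 'M[R]_n), [/\ 0 < lam, B \in unitmx &
         forall (f : cvx0 R n) (x : 'cV[R]_n),
           ((c * lam)%R%:E * geometric_transform f (B *m x)%R <= T f x)%E /\
           (T f x <= (C * lam)%R%:E * geometric_transform f (B *m x)%R)%E]) \/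
      (exists (lam : R) (B : 'M[R]_n), [/\ 0 < lam, B \in unitmx &
         forall (f : cvx0 R n) (x : 'cV[R]_n),
           ((c * lam)%R%:E * legendre f (B *m x)%R <= T f x)%E /\
           (T f x <= (C * lam)%R%:E * legendre f (B *m x)%R)%E])].
Proof.
have C0 : 0 < Ct by exact: lt_trans hCt.
(* Dominates the constants of both cases; the largest one comes from [indicator_type_ge]. *)
pose D := 2 * Ct ^+ 12; have D0 : 0 < D by rewrite mulr_gt0 ?exprn_gt0.
have D9 : 2 * Ct ^+ 9 <= D by rewrite ler_pM2l // ler_weXn2l // ltW.
have D2 : Ct ^+ 2 <= D.
  by apply: le_trans (_ : Ct ^+ 12 <= _); [rewrite ler_weXn2l // ltW | rewrite ler_peMl // ?ltW ?exprn_gt0 // ltr1n].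
have D1 : Ct <= D by apply: le_trans D2; rewrite expr2 ler_peMl // ltW.
exists D^-1, D; split; [by rewrite invr_gt0 | by [] |].
move=> n T T' n2 K K' HT HT'; have H := almost_iso_gtr hCt K K' HT HT'.
have TE f : T f = (T \o @gtr R n) (gtr f) by rewrite /= gtrK.
have [A|A] := all_ind_or_all_lin n2 H; [left | right].
- have [B Bu SE] := all_ind_linear n2 H A.
  pose x : 'cV[R]_n := delta_mx (Ordinal (ltnW n2)) 0.
  have x0 : x != 0.
    apply/eqP => /matrixP/(_ (Ordinal (ltnW n2)) 0); rewrite !mxE !eqxx => /eqP.
    by rewrite oner_eq0.
  have l0 := tip_gt0 H Bu SE x0 ltr01; set l := tip _ _ _ _ in l0.
  exists l, (invmx B); split=> //; first by rewrite unitmx_inv.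
  move=> f y; apply: two_sided_bound => //; first exact: geometric_transform_ge0.
    move=> z v v0; rewrite -gtrE TE => le1.
    apply: le_trans (indicator_type_le n2 H Bu SE x0 v0 le1) _.
    by rewrite lee_fin !ler_pM2r.
  move=> z v v0; rewrite -gtrE TE; exact: (indicator_type_ge n2 H Bu SE x0 v0).
- have [l [B [l0 Bu SE]]] := all_lin_linear n2 H A.
  exists l, (invmx B); split=> //; first by rewrite unitmx_inv.
  move=> f y; apply: two_sided_bound => //; first exact: legendre_ge0.
    move=> z v v0 le1; rewrite TE.
    apply: le_trans (linear_type_le H l0 SE v0 le1) _.
    by rewrite lee_fin !ler_pM2r.
  move=> z v v0; rewrite TE => /(linear_type_ge H l0 Bu SE v0) le1.
  by apply: le_trans le1 _; rewrite lee_fin !ler_pM2r ?invr_gt0.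
Qed.
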